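(* Let $M$ be a manifold, $E$ an oriented vector bundle over $M$ of rank $4n$ and $h$ a neutral metric of $E$, and let $\varepsilon\in\{+,-\}$. For an $\varepsilon$-nilpotent structure $N$ of $(E,h)$, put $\pi_N:={\rm Im}\,N={\rm Ker}\,N$ (a subbundle of $E$ of rank $2n$), let $N^*$ be the section of ${\rm End}\,E^*$ given by $N^*\phi^*:=\phi^*\circ N$, and set $\Theta_N(\phi^*,\psi^* ):=h^*(\phi^*,N^*\psi^* )$ for local sections $\phi^*,\psi^*$ of $E^*$. Then there exists a one-to-one correspondence between the set of $\varepsilon$-nilpotent structures of $(E,h)$ and the set of nondegenerate sections of the $2$-fold exterior powers $\bigwedge^2 L$ of $\varepsilon$-light-like subbundles $L$ of $(E,h)$: each $\varepsilon$-nilpotent structure $N$ corresponds to $\Theta_N$, which is a nondegenerate section of $\bigwedge^2\pi_N$.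
   Context: Everything is smooth. $h$ neutral means that $h$ is a bundle metric of signature $(2n,2n)$. An ordered pseudo-orthonormal local frame field $e=(e_1,\dots,e_{4n})$ of $(E,h)$ always has $e_1,\dots,e_{2n}$ space-like ($h(e_i,e_i)=1$) and $e_{2n+1},\dots,e_{4n}$ time-like ($h(e_i,e_i)=-1$). $E^*$ is the dual bundle and $h^*$ the neutral metric of $E^*$ induced by $h$. Sections of $\bigwedge^2E$ are identified with alternating bilinear forms on $E^*$, with $(a\wedge b)(\phi^*,\psi^* )=\phi^*(a)\psi^*(b)-\psi^*(a)\phi^*(b)$. Set $I_{1,\pm}:=\pm1$ and $I_{n,\pm}:={\rm diag}(\pm1,1,\dots,1)$ ($n\times n$) for $n\ge2$; $I'_{4n,\varepsilon}:={\rm diag}(I_n,I_n,I_n,I_{n,\varepsilon})$ (block diagonal), and $$\Lambda_n:=\left[\begin{array}{cccc}O_n&-I_n&O_n&I_n\\ I_n&O_n&I_n&O_n\\ O_n&I_n&O_n&-I_n\\ I_n&O_n&I_n&O_n\end{array}\right],$$ with $I_n$, $O_n$ the $n\times n$ unit and zero matrices. A section $N$ of ${\rm End}\,E$ is an $\varepsilon$-nilpotent structure of $(E,h)$ if on a neighborhood of each point of $M$ there is an ordered pseudo-orthonormal local frame field $e$ of $(E,h)$ giving the orientation of $E$ with $NeI'_{4n,\varepsilon}=eI'_{4n,\varepsilon}\Lambda_n$ (frames are treated as row vectors). A subbundle $L$ of $E$ of rank $2n$ is an $\varepsilon$-light-like subbundle of $(E,h)$ if on a neighborhood of each point of $M$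 there is an ordered pseudo-orthonormal local frame field $e$ of $(E,h)$ giving the orientation of $E$ such that $$\xi_1:=e_1-e_{2n+1},\quad \xi_i:=e_i-e_{2n+i},\quad \xi_{n+1}:=e_{n+1}+\varepsilon e_{3n+1},\quad \xi_{n+i}:=e_{n+i}+e_{3n+i}\quad(i=2,\dots,n)$$ form a local frame field of $L$. A section $\Theta$ of $\bigwedge^2L$ is nondegenerate if its $n$-fold exterior power $\Theta^n$ is a nowhere zero section of $\bigwedge^{2n}L$. *)

(* Defs.v *)
From HB Require Import structures.
From mathcomp Require Import all_boot all_order all_algebra all_fingroup.
From mathcomp Require Import all_classical all_reals all_analysis.
Set Implicit Arguments.
Unset Strict Implicit.
Unset Printing Implicit Defensive.
Import Order.TTheory GRing.Theory Num.Theory.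
Import numFieldNormedType.Exports.
Local Open Scope classical_set_scope.
Local Open Scope ring_scope.

(* Functions and sections are total; a predicate "on U" only constrains their
   values on the open set U.                                                  *)

(* Class C^k in terms of iterated partial derivatives, on an open set U. *)
Fixpoint Ck_on (R : realType) (m k : nat) (U : set 'rV[R]_m)
    (f : 'rV[R]_m -> R) : Prop :=
  (forall y, U y -> {for y, continuous f}) /\
  match k with
  | 0%N => True
  | k'.+1 => forall i : 'I_m,
      (forall y, U y -> derivable f y (delta_mx 0 i)) /\
      Ck_on k' U (fun y => 'D_(delta_mx 0 i) f y)
  end.

Definition smooth_rV (R : realType) (m : nat) (U : set 'rV[R]_m)
    (f : 'rV[R]_m -> R) : Prop := forall k, Ck_on k U f.

(* A homeomorphism from an open subset of T onto an open subset of R^m;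
   chart_inv is only meaningful on the image chart_map @` chart_dom.    *)
Record chart (R : realType) (m : nat) (T : topologicalType) := Chart {
  chart_dom : set T;
  chart_map : T -> 'rV[R]_m;
  chart_inv : 'rV[R]_m -> T;
  chart_dom_open : open chart_dom;
  chart_img_open : open (chart_map @` chart_dom);
  chart_map_cont : forall x, chart_dom x -> {for x, continuous chart_map};
  chart_inv_cont : forall y, (chart_map @` chart_dom) y ->
    {for y, continuous chart_inv};
  chart_mapK : forall x, chart_dom x -> chart_inv (chart_map x) = x }.

Record manifold (R : realType) (m : nat) := Manifold {
  mcarrier :> topologicalType;
  m_hausdorff : hausdorff_space mcarrier;
  m_second_countable : @second_countable mcarrier;
  atlas : set (chart R m mcarrier);
  atlas_cover : forall x, exists2 c, atlas c & chart_dom c x;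
  atlas_compat : forall c c', atlas c -> atlas c' -> forall j : 'I_m,
    smooth_rV (chart_map c @` (chart_dom c `&` chart_dom c'))
      (fun y => chart_map c' (chart_inv c y) 0 j) }.
Arguments atlas {R m} M : rename.

Definition smooth_on (R : realType) (m : nat) (M : manifold R m) (U : set M)
    (f : M -> R) : Prop :=
  forall c, atlas M c ->
    smooth_rV (chart_map c @` (U `&` chart_dom c)) (f \o chart_inv c).

(* A local trivialization of a family of vector spaces, given by the local
   frame corresponding to the standard basis of R^r.                       *)
Record trivialization (R : realType) (T : topologicalType)
    (F : T -> vectType R) (r : nat) := Trivialization {
  triv_dom : set T;
  triv_frame : forall x, r.-tuple (F x);
  triv_dom_open : open triv_dom;
  triv_basis : forall x, triv_dom x -> basis_of fullv (triv_frame x) }.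

Record vbundle (R : realType) (m : nat) (M : manifold R m) (r : nat) :=
  VBundle {
  fiber :> M -> vectType R;
  trivs : set (trivialization fiber r);
  trivs_cover : forall x, exists2 t, trivs t & triv_dom t x;
  trivs_compat : forall t t', trivs t -> trivs t' -> forall i j : 'I_r,
    smooth_on (triv_dom t `&` triv_dom t')
      (fun x => coord (triv_frame t x) i (tnth (triv_frame t' x) j)) }.
Arguments trivs {R m M r} E : rename.

Section Bundles.
Variables (R : realType) (m : nat) (M : manifold R m) (r : nat).
Variable E : vbundle M r.

Definition smooth_section (U : set M) (s : forall x, E x) : Prop :=
  forall t, trivs E t -> forall i : 'I_r,
    smooth_on (U `&` triv_dom t) (fun x => coord (triv_frame t x) i (s x)).

Definition local_frame (U : set M) (e : forall x, r.-tuple (E x)) : Prop :=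
  (forall x, U x -> basis_of fullv (e x)) /\
  (forall i : 'I_r, smooth_section U (fun x => tnth (e x) i)).

Definition End_section (N : forall x, 'End(E x)) : Prop :=
  forall t, trivs E t -> forall j : 'I_r,
    smooth_section (triv_dom t) (fun x => N x (tnth (triv_frame t x) j)).

(* L is spanned near each point by k smooth sections of E, linearly independent
   at each point.                                                              *)
Definition subbundle (k : nat) (L : forall x, {vspace E x}) : Prop :=
  forall x0 : M, exists (U : set M) (xi : forall x, k.-tuple (E x)),
    [/\ open U, U x0,
        forall i : 'I_k, smooth_section U (fun x => tnth (xi x) i) &
        forall x, U x -> basis_of (L x) (xi x)].

(* An orientation of E: in each fiber, one of the two classes of ordered bases
   (the positive ones), chosen continuously.                                  *)
Record orientation := Orientation {
  positive :> forall x, set (r.-tuple (E x));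
  positive_basis : forall x (X : r.-tuple (E x)), @positive x X -> basis_of fullv X;
  positive_class : forall x (X Y : r.-tuple (E x)), @positive x X -> basis_of fullv Y ->
    (@positive x Y <-> 0 < \det (\matrix_(i, j) coord X i (tnth Y j)));
  positive_frame : forall x0 : M,
    exists (U : set M) (e : forall x, r.-tuple (E x)),
      [/\ open U, U x0, local_frame U e & forall x, U x -> @positive x (e x)] }.

Arguments positive o x : rename.

Definition dual (x : M) : vectType R := 'Hom(E x, R^o).

Definition dual_tuple (x : M) (X : r.-tuple (E x)) (i : 'I_r) : dual x :=
  linfun (coord X i : E x -> R^o).

Definition wedge (x : M) (a b : E x) : dual x -> dual x -> R :=
  fun phi psi => phi a * psi b - psi a * phi b.

(* The fiber at x of the second exterior power of L, as a set of alternating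
   bilinear forms on the dual of the fiber of E.                             *)
Definition Lambda2 (L : forall x, {vspace E x}) (x : M) :
    set (dual x -> dual x -> R) :=
  [set w | exists (k : nat) (a b : 'I_k -> E x),
     (forall i, a i \in L x /\ b i \in L x) /\
     (forall phi psi, w phi psi = \sum_(i < k) wedge (a i) (b i) phi psi)].

Definition Lambda2_section (L : forall x, {vspace E x})
    (Theta : forall x, dual x -> dual x -> R) : Prop :=
  (forall x, Lambda2 L (Theta x)) /\
  (forall t, trivs E t -> forall i j : 'I_r,
     smooth_on (triv_dom t)
       (fun x => Theta x (dual_tuple (triv_frame t x) i)
                         (dual_tuple (triv_frame t x) j))).

End Bundles.

Section ExteriorPowers.
Variables (R : realType) (V : Type).

(* Exterior product of alternating multilinear forms; for p = q = 1 this is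
   the convention of [wedge].                                               *)
Definition wedge_form (p q : nat) (a : ('I_p -> V) -> R)
    (b : ('I_q -> V) -> R) : ('I_(p + q) -> V) -> R :=
  fun v => ((p`! * q`!)%N%:R)^-1 *
    \sum_(s : 'S_(p + q)) (-1) ^+ s * a (fun i => v (s (lshift q i)))
                                    * b (fun j => v (s (rshift p j))).

Fixpoint wedge_exp (w : V -> V -> R) (k : nat) : ('I_(k.*2) -> V) -> R :=
  match k return ('I_(k.*2) -> V) -> R with
  | 0%N => fun=> 1
  | k'.+1 => wedge_form (fun v : 'I_2 -> V => w (v ord0) (v ord_max))
                        (@wedge_exp w k')
  end.

End ExteriorPowers.
Arguments wedge_exp {R V} w k v : rename.

(* The n-fold exterior power of a section of the second exterior power of L
   vanishes nowhere (exterior powers of L being contained in those of E).   *)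
Definition nondegenerate_section (R : realType) (m : nat) (M : manifold R m)
    (r : nat) (E : vbundle M r) (n : nat) (L : forall x, {vspace E x})
    (Theta : forall x, dual E x -> dual E x -> R) : Prop :=
  Lambda2_section L Theta /\
  forall x, exists phi : 'I_(n.*2) -> dual E x,
    wedge_exp (Theta x) n phi != 0.

Definition pseudo_orthonormal (R : realType) (V : vectType R) (p q : nat)
    (b : V -> V -> R) (X : (p + q).-tuple V) : Prop :=
  forall i j : 'I_(p + q), b (tnth X i) (tnth X j) =
    if i == j then (if (i < p)%N then 1 else -1) else 0.

Record bundle_metric (R : realType) (m : nat) (M : manifold R m) (p q : nat)
    (E : vbundle M (p + q)) := BundleMetric {
  metric :> forall x, E x -> E x -> R;
  metric_sym : forall x (a b : E x), metric a b = metric b a;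
  metric_linear : forall x k (a b c : E x),
    metric (k *: a + b) c = k * metric a c + metric b c;
  metric_smooth : forall t, trivs E t -> forall i j : 'I_(p + q),
    smooth_on (triv_dom t)
      (fun x => metric (tnth (triv_frame t x) i) (tnth (triv_frame t x) j));
  metric_signature : forall x, exists X : (p + q).-tuple (E x),
    basis_of fullv X /\ pseudo_orthonormal (@metric x) X }.

Section InducedMetric.
Variables (R : realType) (m : nat) (M : manifold R m) (p q : nat).
Variables (E : vbundle M (p + q)) (h : bundle_metric E).

Definition flat (x : M) : 'Hom(E x, dual E x) :=
  linfun (fun a : E x => linfun (h x a : E x -> R^o) : dual E x).

Definition dual_metric (x : M) (phi psi : dual E x) : R :=
  h x ((flat x)^-1%VF phi) ((flat x)^-1%VF psi).

Definition pi_ (N : forall x, 'End(E x)) (x : M) : {vspace E x} := limg (N x).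

Definition dual_end (N : forall x, 'End(E x)) (x : M) (phi : dual E x) :
    dual E x := (phi \o N x)%VF.

Definition Theta_ (N : forall x, 'End(E x)) (x : M) (phi psi : dual E x) : R :=
  dual_metric phi (dual_end N psi).

End InducedMetric.

Section EpsilonStructures.
Variable R : realType.

(* The sign eps is encoded as a boolean, + being true. *)
Definition sgn (eps : bool) : R := if eps then 1 else -1.

Definition In_eps (n : nat) (eps : bool) : 'M[R]_n :=
  diag_mx (\row_(i < n) if (i : nat) == 0%N then sgn eps else 1).

Definition I'_ (n : nat) (eps : bool) : 'M[R]_(n + n + (n + n)) :=
  block_mx 1%:M 0 0 (block_mx 1%:M 0 0 (In_eps n eps)).

Definition Lambda_ (n : nat) : 'M[R]_(n + n + (n + n)) :=
  block_mx (block_mx 0 (- 1%:M) 1%:M 0) (block_mx 0 1%:M 1%:M 0)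
           (block_mx 0 1%:M 1%:M 0) (block_mx 0 (- 1%:M) 1%:M 0).

(* The product X A of a row of r vectors by a matrix. *)
Definition frame_mul (V : vectType R) (r : nat) (X : r.-tuple V)
    (A : 'M[R]_r) : r.-tuple V :=
  [tuple \sum_(i < r) A i j *: tnth X i | j < r].

(* The vectors xi_1, ..., xi_2n built from e_1, ..., e_4n. *)
Definition xi_ (V : vectType R) (n : nat) (eps : bool)
    (e : (n + n + (n + n)).-tuple V) : (n + n).-tuple V :=
  let e1 i := tnth e (lshift (n + n) (lshift n i)) in
  let e2 i := tnth e (lshift (n + n) (rshift n i)) in
  let e3 i := tnth e (rshift (n + n) (lshift n i)) in
  let e4 i := tnth e (rshift (n + n) (rshift n i)) in
  [tuple match fintype.split k with
         | inl i => e1 i - e3 i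
         | inr i => e2 i + (if (i : nat) == 0%N then sgn eps else 1) *: e4 i
         end | k < n + n].

Variables (m : nat) (M : manifold R m) (n : nat).
Variables (E : vbundle M (n + n + (n + n))) (o : orientation E).
Variables (h : bundle_metric E) (eps : bool).

Definition oriented_po_frame (U : set M)
    (e : forall x, (n + n + (n + n)).-tuple (E x)) : Prop :=
  [/\ local_frame U e,
      forall x, U x -> pseudo_orthonormal (h x) (e x) &
      forall x, U x -> o x (e x)].

Definition nilpotent_structure (N : forall x, 'End(E x)) : Prop :=
  End_section N /\
  forall x0 : M, exists (U : set M) (e : forall x, (n + n + (n + n)).-tuple (E x)),
    [/\ open U, U x0, oriented_po_frame U e &
        forall x, U x ->
          map_tuple (N x) (frame_mul (e x) (I'_ n eps)) =
          frame_mul (frame_mul (e x) (I'_ n eps)) (Lambda_ n)].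

Definition lightlike_subbundle (L : forall x, {vspace E x}) : Prop :=
  subbundle (n + n) L /\
  forall x0 : M, exists (U : set M) (e : forall x, (n + n + (n + n)).-tuple (E x)),
    [/\ open U, U x0, oriented_po_frame U e &
        forall x, U x -> basis_of (L x) (xi_ eps (e x))].

End EpsilonStructures.

(* Main.v *)
From HB Require Import structures.
Require Import Defs.
From mathcomp Require Import all_boot all_order all_algebra all_fingroup.
From mathcomp Require Import all_classical all_reals all_analysis.
Set Implicit Arguments.
Unset Strict Implicit.
Unset Printing Implicit Defensive.
Import Order.TTheory GRing.Theory Num.Theory.
Import numFieldNormedType.Exports.
Local Open Scope classical_set_scope.
Local Open Scope ring_scope.

(** Put xi_1, ..., xi_2n for the light-like vectors built from a
    pseudo-orthonormal frame e.  In the fibre over a point, the matrix equation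
    N e I' = e I' Lambda says exactly that
      N a = sum_i h(xi_i, a) xi_(n+i) - h(xi_(n+i), a) xi_i
    ([nilpotent_frameP]).  Since psi (N a) = Theta_N (h(a, .), psi) and h is
    nondegenerate, N and Theta_N determine each other, and the equation is
    equivalent to the normal form Theta_N = sum_i xi_i /\ xi_(n+i)
    ([Theta_xi_formP]).  So the theorem says that the two-forms having locally
    this normal form, in an oriented pseudo-orthonormal frame, are exactly the
    nondegenerate sections of the second exterior power of the light-like
    subbundles.

    A normal form is nondegenerate: its n-th exterior power, evaluated on a
    basis dual to xi, expands as a sum of squares of determinants one of which
    is 1 ([wedge_exp_symplectic]).

    Conversely, let Theta be a nondegenerate section of the exterior square of
    L, and let xi be the light-like frame of L coming from a frame e.  The
    matrix K with Theta = sum_(a, b) K_ab xi_a (x) xi_b has entries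
    Theta (h(e_a, .), h(e_b, .)) for the space-like e_a, hence is smooth.  It is
    invertible, because an antisymmetric form supported on fewer than 2n vectors
    has zero n-th power ([wedge_exp_rank]).  Gram-Schmidt for alternating forms
    over the local ring of germs of smooth functions writes K = Z^T J Z with Z
    smooth ([smooth_symplectic_basis]), so that Theta is in normal form with
    respect to xi' = Z xi.  To realise xi' by a frame, transform the
    complementary null vectors 2 e_k - xi_k by the contragredient of Z:
    the result comes from a frame e' that is again pseudo-orthonormal and is
    obtained from e by a matrix of determinant 1, hence is positively oriented
    ([symplectic_adapted_frame]). *)

(** * Smooth functions *)

Lemma near_eq_continuous (T S : topologicalType) (f g : T -> S) (y : T) :
  {near y, f =1 g} -> {for y, continuous f} -> {for y, continuous g}.
Proof.
move=> fg cf; have fgy : f y = g y := nbhs_singleton fg.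
change (g x @[x --> y] --> g y); rewrite -fgy.
by apply: cvg_trans cf; exact: near_eq_cvg.
Qed.

Lemma near_open (T : topologicalType) (P : T -> Prop) (x : T) :
  (\forall z \near x, P z) -> exists V, [/\ open V, V x & forall z, V z -> P z].
Proof.
by move=> nP; exists [set z | P z]^°; split; [exact: open_interior| |exact: interior_subset].
Qed.

Section CkFunctions.
Variables (R : realType) (m : nat).
Implicit Types (U V : set 'rV[R]_m) (f g : 'rV[R]_m -> R) (k : nat).

(** The condition only involves the points of U one at a time, so it can be
    checked locally. *)
Lemma Ck_on_point k U f :
  Ck_on k U f <-> forall y, U y -> Ck_on k [set y] f.
Proof.
elim: k f => [|k IH] f; split.
- by move=> [cf _] y Uy; split => // z ->; exact: cf.
- by move=> H; split => // y Uy; have [cf _] := H y Uy; exact: cf.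
- move=> [cf H] y Uy; split; first by move=> z ->; exact: cf.
  move=> i; have [df Df] := H i; split; first by move=> z ->; exact: df.
  by have /IH := Df; exact.
- move=> H; split; first by move=> y Uy; have [cf _] := H y Uy; exact: cf.
  move=> i; split; first by move=> y Uy; have [_ /(_ i)[df _]] := H y Uy; exact: df.
  by apply/IH => y Uy; have [_ /(_ i)[_ Df]] := H y Uy.
Qed.

Lemma Ck_onS k U f : Ck_on k.+1 U f -> Ck_on k U f.
Proof.
elim: k f => [|k IH] f [cf H]; split => //.
by move=> i; have [df Df] := H i; split => //; exact: IH.
Qed.

Lemma Ck_on_eq k U f g : open U -> (forall y, U y -> f y = g y) ->
  Ck_on k U f -> Ck_on k U g.
Proof.
move=> oU.
have near_fg (f1 g1 : 'rV[R]_m -> R) : (forall y, U y -> f1 y = g1 y) ->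
    forall y, U y -> {near y, f1 =1 g1}.
  by move=> fg y Uy; near=> z; apply: fg; near: z; exact: open_nbhs_nbhs.
elim: k f g => [|k IH] f g fg [cf H].
  by split=> // y Uy; apply: near_eq_continuous (cf y Uy); exact: near_fg.
split; first by move=> y Uy; apply: near_eq_continuous (cf y Uy); exact: near_fg.
have nfg := near_fg _ _ fg.
move=> i; have [df Df] := H i; split.
  by move=> y Uy; apply: near_eq_derivable (df y Uy); exact: nfg.
apply: IH Df => y Uy; apply: near_eq_derive; exact: nfg.
Unshelve. all: by end_near. Qed.

Lemma Ck_on_cst k U (a : R) : open U -> Ck_on k U (fun=> a).
Proof.
move=> oU; elim: k a => [|k IH] a; split=> //; try by move=> y _; exact: cst_continuous.
move=> i; split; first by move=> y _; exact: derivable_cst.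
by apply: Ck_on_eq (IH 0) => // y _; rewrite (derive_cst a).
Qed.

Lemma Ck_onD k U f g : open U -> Ck_on k U f -> Ck_on k U g ->
  Ck_on k U (fun y => f y + g y).
Proof.
move=> oU; elim: k f g => [|k IH] f g [cf Hf] [cg Hg].
  by split=> // y Uy; apply: continuousD; [exact: cf | exact: cg].
split; first by move=> y Uy; apply: continuousD; [exact: cf | exact: cg].
move=> i; have [df Df] := Hf i; have [dg Dg] := Hg i; split.
  by move=> y Uy; apply: derivableD; [exact: df | exact: dg].
apply: Ck_on_eq (IH _ _ Df Dg) => // y Uy.
by rewrite (@deriveD _ _ _ f g) //; [exact: df | exact: dg].
Qed.

Lemma Ck_onM k U f g : open U -> Ck_on k U f -> Ck_on k U g ->
  Ck_on k U (fun y => f y * g y).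
Proof.
move=> oU; elim: k f g => [|k IH] f g Cf Cg; have [cf Hf] := Cf; have [cg Hg] := Cg.
  by split=> // y Uy; apply: continuousM; [exact: cf | exact: cg].
split; first by move=> y Uy; apply: continuousM; [exact: cf | exact: cg].
move=> i; have [df Df] := Hf i; have [dg Dg] := Hg i; split.
  by move=> y Uy; apply: derivableM; [exact: df | exact: dg].
have := Ck_onD oU (IH _ _ (Ck_onS Cf) Dg) (IH _ _ (Ck_onS Cg) Df).
apply: Ck_on_eq => // y Uy.
by rewrite (@deriveM _ _ f g) //; [exact: df | exact: dg].
Qed.

Lemma Ck_onV k U f : open U -> (forall y, U y -> f y != 0) -> Ck_on k U f ->
  Ck_on k U (fun y => (f y)^-1).
Proof.
move=> oU f0; elim: k => [|k IH] Cf; have [cf Hf] := Cf.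
  by split=> // y Uy; apply: continuousV; [exact: f0 | exact: cf].
split; first by move=> y Uy; apply: continuousV; [exact: f0 | exact: cf].
move=> i; have [df Df] := Hf i; split.
  by move=> y Uy; apply: derivableV; [exact: f0 | exact: df].
have CV := IH (Ck_onS Cf).
have := Ck_onM oU (Ck_on_cst k (-1) oU) (Ck_onM oU (Ck_onM oU CV CV) Df).
apply: Ck_on_eq => // y Uy.
rewrite deriveV ?f0 //; last exact: df.
by rewrite expr2 invfM /GRing.scale /= mulN1r mulNr.
Qed.

End CkFunctions.

Section SmoothFunctions.
Variables (R : realType) (m : nat) (M : manifold R m).
Implicit Types (U V : set M) (f g : M -> R).

(** Pointwise form of smoothness, from which locality follows. *)
Lemma smooth_onP U f : smooth_on U f <->
  forall x, U x -> forall c, atlas M c -> chart_dom c x ->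
  forall k, Ck_on k [set chart_map c x] (f \o chart_inv c).
Proof.
split.
  move=> H x Ux c Ac cx k; have /Ck_on_point := H c Ac k.
  by apply; exists x.
move=> H c Ac k; apply/Ck_on_point => _ [x [Ux cx] <-]; exact: H.
Qed.

Lemma smooth_on_local U f :
  (forall x, U x -> exists2 V, V x & smooth_on V f) -> smooth_on U f.
Proof.
move=> H; apply/smooth_onP => x Ux c Ac cx k; have [V Vx /smooth_onP sV] := H x Ux.
exact: sV.
Qed.

Lemma smooth_on_sub U V f : V `<=` U -> smooth_on U f -> smooth_on V f.
Proof.
move=> VU /smooth_onP H; apply/smooth_onP => x Vx; exact: H (VU _ Vx).
Qed.

Lemma open_chart_image U (c : chart R m M) :
  open U -> open (chart_map c @` (U `&` chart_dom c)).
Proof.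
move=> oU; rewrite openE => _ [x [Ux cx] <-]; rewrite /interior.
have cimg : (chart_map c @` chart_dom c) (chart_map c x) by exists x.
have nU : nbhs (chart_inv c (chart_map c x)) U.
  by rewrite chart_mapK //; exact: open_nbhs_nbhs.
have := chart_inv_cont cimg nU; rewrite nbhs_filterE => near1.
have near2 := open_nbhs_nbhs (conj (@chart_img_open _ _ _ c) cimg).
near=> y.
have [z cz zy] : (chart_map c @` chart_dom c) y by near: y.
exists z => //; split=> //; rewrite -(chart_mapK cz) zy; by near: y.
Unshelve. all: by end_near. Qed.

Lemma smooth_on_eq U f g : open U -> (forall x, U x -> f x = g x) ->
  smooth_on U f -> smooth_on U g.
Proof.
move=> oU fg sf c Ac k; apply: Ck_on_eq (sf c Ac k); first exact: open_chart_image.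
by move=> _ [x [Ux cx] <-] /=; rewrite chart_mapK // fg.
Qed.

Lemma smooth_on_cst U (a : R) : open U -> smooth_on U (fun=> a).
Proof. move=> oU c Ac k; apply: Ck_on_cst; exact: open_chart_image. Qed.

Lemma smooth_onD U f g : open U -> smooth_on U f -> smooth_on U g ->
  smooth_on U (fun x => f x + g x).
Proof.
move=> oU sf sg c Ac k.
have := Ck_onD (open_chart_image (c := c) oU) (sf c Ac k) (sg c Ac k); exact.
Qed.

Lemma smooth_onM U f g : open U -> smooth_on U f -> smooth_on U g ->
  smooth_on U (fun x => f x * g x).
Proof.
move=> oU sf sg c Ac k.
have := Ck_onM (open_chart_image (c := c) oU) (sf c Ac k) (sg c Ac k); exact.
Qed.

Lemma smooth_onV U f : open U -> (forall x, U x -> f x != 0) ->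
  smooth_on U f -> smooth_on U (fun x => (f x)^-1).
Proof.
move=> oU f0 sf c Ac k.
have := Ck_onV (open_chart_image (c := c) oU) _ (sf c Ac k); apply.
by move=> _ [x [Ux cx] <-] /=; rewrite chart_mapK ?f0.
Qed.

Lemma smooth_onN U f : open U -> smooth_on U f -> smooth_on U (fun x => - f x).
Proof.
move=> oU sf; apply: smooth_on_eq (smooth_onM oU (smooth_on_cst (-1) oU) sf) => //.
by move=> x _; rewrite mulN1r.
Qed.

Lemma smooth_onB U f g : open U -> smooth_on U f -> smooth_on U g ->
  smooth_on U (fun x => f x - g x).
Proof. by move=> oU sf sg; apply: smooth_onD => //; exact: smooth_onN. Qed.

Lemma smooth_on_sum (I : Type) (r : seq I) (P : pred I) U (F : I -> M -> R) :
  open U -> (forall i, smooth_on U (F i)) ->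
  smooth_on U (fun x => \sum_(i <- r | P i) F i x).
Proof.
move=> oU sF; elim: r => [|i r IH].
  by apply: smooth_on_eq (smooth_on_cst 0 oU) => // x _; rewrite big_nil.
case Pi: (P i); last by apply: smooth_on_eq IH => // x _; rewrite big_cons Pi.
by apply: smooth_on_eq (smooth_onD oU (sF i) IH) => // x _; rewrite big_cons Pi.
Qed.

Lemma smooth_on_continuous U f x : open U -> U x -> smooth_on U f ->
  {for x, continuous f}.
Proof.
move=> oU Ux sf; have [c Ac cx] := atlas_cover x.
have /smooth_onP/(_ x Ux c Ac cx 0%N)[cf _] := sf.
have cm := chart_map_cont cx.
apply: near_eq_continuous (continuous_comp cm (cf _ erefl)).
near=> z => /=; rewrite chart_mapK //; near: z.
by apply: open_nbhs_nbhs; split=> //; exact: chart_dom_open.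
Unshelve. all: by end_near. Qed.

(** f defines a germ of smooth function at x.  Such germs form a local ring: a
    germ that does not vanish at x is invertible. *)
Definition smooth_near (x : M) f := exists U, [/\ open U, U x & smooth_on U f].

Lemma smooth_near_eq x f g : (\forall z \near x, f z = g z) ->
  smooth_near x f -> smooth_near x g.
Proof.
move=> /near_open[V [oV Vx Vfg]] [U [oU Ux sf]].
exists (U `&` V); split=> //; first exact: openI.
apply: smooth_on_eq (smooth_on_sub _ sf); first exact: openI.
  by move=> z [_ Vz]; exact: Vfg.
by move=> z [].
Qed.

Lemma smooth_near_cst x (a : R) : smooth_near x (fun=> a).
Proof. by exists setT; split=> //; [exact: openT | apply: smooth_on_cst; exact: openT]. Qed.

Lemma smooth_near2 x f g : smooth_near x f -> smooth_near x g ->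
  exists U, [/\ open U, U x, smooth_on U f & smooth_on U g].
Proof.
move=> [U [oU Ux sf]] [V [oV Vx sg]]; exists (U `&` V); split=> //.
- exact: openI.
- by apply: smooth_on_sub sf => z [].
- by apply: smooth_on_sub sg => z [].
Qed.

Lemma smooth_nearD x f g : smooth_near x f -> smooth_near x g ->
  smooth_near x (fun z => f z + g z).
Proof.
by move=> sf sg; have [U [*]] := smooth_near2 sf sg; exists U; split=> //; exact: smooth_onD.
Qed.

Lemma smooth_nearM x f g : smooth_near x f -> smooth_near x g ->
  smooth_near x (fun z => f z * g z).
Proof.
by move=> sf sg; have [U [*]] := smooth_near2 sf sg; exists U; split=> //; exact: smooth_onM.
Qed.

Lemma smooth_nearN x f : smooth_near x f -> smooth_near x (fun z => - f z).
Proof. by move=> [U [*]]; exists U; split=> //; exact: smooth_onN. Qed.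

Lemma smooth_near_continuous x f : smooth_near x f -> {for x, continuous f}.
Proof. by move=> [U [oU Ux]]; exact: smooth_on_continuous. Qed.

Lemma smooth_near_neq0 x f : smooth_near x f -> f x != 0 ->
  \forall z \near x, f z != 0.
Proof.
move=> /smooth_near_continuous cf fx.
have : open_nbhs (f x) [set y : R | y != 0].
  split=> //; exact: open_neq.
by move/open_nbhs_nbhs => /cf; rewrite nbhs_filterE.
Qed.

Lemma smooth_nearV x f : smooth_near x f -> f x != 0 ->
  smooth_near x (fun z => (f z)^-1).
Proof.
move=> sf fx; have /near_open[V [oV Vx Vf]] := smooth_near_neq0 sf fx; have [U [oU Ux sU]] := sf.
exists (U `&` V); split=> //; first exact: openI.
apply: smooth_onV; first exact: openI.
- by move=> z [_ /Vf].
- by apply: smooth_on_sub sU => z [].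
Qed.

Lemma smooth_near_sum (I : Type) (r : seq I) (P : pred I) x (F : I -> M -> R) :
  (forall i, smooth_near x (F i)) ->
  smooth_near x (fun z => \sum_(i <- r | P i) F i z).
Proof.
move=> sF; elim: r => [|i r IH].
  by apply: smooth_near_eq (smooth_near_cst x 0); near=> z; rewrite big_nil.
case Pi: (P i); last by apply: smooth_near_eq IH; near=> z; rewrite big_cons Pi.
by apply: smooth_near_eq (smooth_nearD (sF i) IH); near=> z; rewrite big_cons Pi.
Unshelve. all: by end_near. Qed.

Lemma smooth_near_prod (I : Type) (r : seq I) (P : pred I) x (F : I -> M -> R) :
  (forall i, smooth_near x (F i)) ->
  smooth_near x (fun z => \prod_(i <- r | P i) F i z).
Proof.
move=> sF; elim: r => [|i r IH].
  by apply: smooth_near_eq (smooth_near_cst x 1); near=> z; rewrite big_nil.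
case Pi: (P i); last by apply: smooth_near_eq IH; near=> z; rewrite big_cons Pi.
by apply: smooth_near_eq (smooth_nearM (sF i) IH); near=> z; rewrite big_cons Pi.
Unshelve. all: by end_near. Qed.

(** Finitely many germs are smooth on a common neighbourhood. *)
Lemma smooth_near_forall (I : finType) x (F : I -> M -> R) :
  (forall i, smooth_near x (F i)) ->
  exists U, [/\ open U, U x & forall i, smooth_on U (F i)].
Proof.
move=> sF.
have : \forall z \near x, forall i, exists2 V, V z & smooth_on V (F i).
  apply: filter_forall => i; have [U [oU Ux sU]] := sF i.
  have nU := open_nbhs_nbhs (conj oU Ux).
  by near=> z; exists U => //; near: z.
move=> /near_open[V [oV Vx VF]]; exists V; split=> // i.
by apply: smooth_on_local => z Vz; exact: VF.
Unshelve. all: by end_near. Qed.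

(** A matrix whose entries are germs of smooth functions at x. *)
Definition smooth_mx_near (a b : nat) (x : M) (A : M -> 'M[R]_(a, b)) :=
  forall i j, smooth_near x (fun z => A z i j).

Lemma smooth_mx_near_cst a b x (A : 'M[R]_(a, b)) : smooth_mx_near x (fun=> A).
Proof. by move=> i j; exact: smooth_near_cst. Qed.

Lemma smooth_mx_nearD a b x (A B : M -> 'M[R]_(a, b)) :
  smooth_mx_near x A -> smooth_mx_near x B -> smooth_mx_near x (fun z => A z + B z).
Proof.
move=> sA sB i j; apply: smooth_near_eq (smooth_nearD (sA i j) (sB i j)).
by near=> z; rewrite mxE.
Unshelve. all: by end_near. Qed.

Lemma smooth_mx_nearN a b x (A : M -> 'M[R]_(a, b)) :
  smooth_mx_near x A -> smooth_mx_near x (fun z => - A z).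
Proof.
move=> sA i j; apply: smooth_near_eq (smooth_nearN (sA i j)).
by near=> z; rewrite mxE.
Unshelve. all: by end_near. Qed.

Lemma smooth_mx_nearZ a b x f (A : M -> 'M[R]_(a, b)) :
  smooth_near x f -> smooth_mx_near x A -> smooth_mx_near x (fun z => f z *: A z).
Proof.
move=> sf sA i j; apply: smooth_near_eq (smooth_nearM sf (sA i j)).
by near=> z; rewrite mxE.
Unshelve. all: by end_near. Qed.

Lemma smooth_mx_nearM a b c x (A : M -> 'M[R]_(a, b)) (B : M -> 'M[R]_(b, c)) :
  smooth_mx_near x A -> smooth_mx_near x B -> smooth_mx_near x (fun z => A z *m B z).
Proof.
move=> sA sB i j.
apply: smooth_near_eq (smooth_near_sum _ _ (fun k => smooth_nearM (sA i k) (sB k j))).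
by near=> z; rewrite mxE.
Unshelve. all: by end_near. Qed.

Lemma smooth_mx_near_tr a b x (A : M -> 'M[R]_(a, b)) :
  smooth_mx_near x A -> smooth_mx_near x (fun z => (A z)^T).
Proof.
move=> sA i j; apply: smooth_near_eq (sA j i).
by near=> z; rewrite mxE.
Unshelve. all: by end_near. Qed.

Lemma smooth_mx_near_col a b c x (A : M -> 'M[R]_(a, c)) (B : M -> 'M[R]_(b, c)) :
  smooth_mx_near x A -> smooth_mx_near x B -> smooth_mx_near x (fun z => col_mx (A z) (B z)).
Proof.
move=> sA sB i j; case: (fintype.splitP i) => k ik.
  apply: smooth_near_eq (sA k j); near=> z.
  by have -> : i = lshift b k; [exact: val_inj | rewrite col_mxEu].
apply: smooth_near_eq (sB k j); near=> z.
by have -> : i = rshift a k; [exact: val_inj | rewrite col_mxEd].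
Unshelve. all: by end_near. Qed.

Lemma smooth_mx_near_row a b c x (A : M -> 'M[R]_(c, a)) (B : M -> 'M[R]_(c, b)) :
  smooth_mx_near x A -> smooth_mx_near x B -> smooth_mx_near x (fun z => row_mx (A z) (B z)).
Proof.
move=> sA sB i j; case: (fintype.splitP j) => k jk.
  apply: smooth_near_eq (sA i k); near=> z.
  by have -> : j = lshift b k; [exact: val_inj | rewrite row_mxEl].
apply: smooth_near_eq (sB i k); near=> z.
by have -> : j = rshift a k; [exact: val_inj | rewrite row_mxEr].
Unshelve. all: by end_near. Qed.

Lemma smooth_near_det a x (A : M -> 'M[R]_a) :
  smooth_mx_near x A -> smooth_near x (fun z => \det (A z)).
Proof.
move=> sA; apply: smooth_near_sum => s; apply: smooth_nearM.
  exact: smooth_near_cst.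
by apply: smooth_near_prod => i; exact: sA.
Qed.

Lemma smooth_mx_near_inv a x (A : M -> 'M[R]_a) :
  smooth_mx_near x A -> A x \in unitmx -> smooth_mx_near x (fun z => invmx (A z)).
Proof.
move=> sA; rewrite unitmxE unitfE => dA; have sd := smooth_near_det sA.
have sadj : smooth_mx_near x (fun z => \adj (A z)).
  move=> i j; apply: (@smooth_near_eq x (fun z => (-1) ^+ (j + i) * \det (row' j (col' i (A z))))).
    by near=> z; rewrite mxE.
  apply: smooth_nearM; first exact: smooth_near_cst.
  apply: smooth_near_det => k l; apply: smooth_near_eq (sA (lift j k) (lift i l)).
  by near=> z; rewrite !mxE.
move=> i j; apply: smooth_near_eq (smooth_mx_nearZ (smooth_nearV sd dA) sadj i j).
have nd := smooth_near_neq0 sd dA.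
by near=> z; rewrite /invmx unitmxE unitfE ifT //; near: z.
Unshelve. all: by end_near. Qed.

End SmoothFunctions.

(** * Exterior powers of a two-form and Pfaffian sums *)

(* The 2k slots of a k-fold product of two-forms come in k consecutive pairs. *)
Lemma even_pos_subproof k (i : 'I_k) : (i.*2 < k.*2)%N.
Proof. by rewrite ltn_double. Qed.
Lemma odd_pos_subproof k (i : 'I_k) : (i.*2.+1 < k.*2)%N.
Proof. by rewrite ltn_Sdouble. Qed.

(** First and second slot, 2i and 2i + 1, of the i-th pair. *)
Definition even_pos k (i : 'I_k) : 'I_k.*2 := Ordinal (even_pos_subproof i).
Definition odd_pos k (i : 'I_k) : 'I_k.*2 := Ordinal (odd_pos_subproof i).

Lemma prod_pos (R : comPzRingType) k (F : 'I_k.*2 -> R) :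
  \prod_j F j = \prod_(i < k) (F (even_pos i) * F (odd_pos i)).
Proof.
elim: k F => [|k IH] F; first by rewrite !big_ord0.
rewrite [LHS]big_ord_recl [RHS]big_ord_recl big_ord_recl IH mulrA.
congr (F _ * F _ * _); try exact: val_inj.
by apply: eq_bigr => i _; congr (F _ * F _); apply: val_inj.
Qed.

(** The sum over all permutations that defines k! times the Pfaffian of the
    alternating form g - g^T. *)
Definition pf_sum (R : comPzRingType) (V : Type) k (g : V -> V -> R) (v : 'I_k.*2 -> V) : R :=
  \sum_(s : 'S_k.*2) (-1) ^+ s *
     \prod_(i < k) g (v (s (even_pos i))) (v (s (odd_pos i))).

Section WedgeExp.
Variables (R : realType) (V : Type).
Implicit Types (w g : V -> V -> R).

(** The powers of two of the factors w = g - g^T cancel those in the factorials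
    of the exterior product, so no normalisation is left. *)
Lemma wedge_exp_pf_sum w g k (v : 'I_k.*2 -> V) :
  (forall a b, w a b = g a b - g b a) -> wedge_exp w k v = pf_sum g v.
Proof.
move=> wg; elim: k v => [|k IH] v.
  rewrite /pf_sum (big_pred1 (1%g : 'S_0.*2)) /=; last first.
    by move=> s; apply/esym/eqP/permP => -[].
  by rewrite odd_perm1 expr0 mul1r big_ord0.
rewrite /= /wedge_form.
pose o0 : 'I_k.+1.*2 := even_pos ord0; pose o1 : 'I_k.+1.*2 := odd_pos ord0.
pose rest (s : 'S_k.+1.*2) :=
  \prod_(i < k) g (v (s (even_pos (lift ord0 i)))) (v (s (odd_pos (lift ord0 i)))).
pose F (s : 'S_k.+1.*2) := (-1) ^+ s * w (v (s o0)) (v (s o1)) * rest s.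
pose G (s : 'S_k.+1.*2) := (-1) ^+ s * g (v (s o0)) (v (s o1)) * rest s.
have pfG : pf_sum g v = \sum_s G s.
  by apply: eq_bigr => s _; rewrite big_ord_recl mulrA.
(* exchanging the first two arguments turns the second term of w into the first *)
have FG : \sum_s F s = 2 * \sum_s G s.
  have -> : \sum_s F s = \sum_s (G s - (-1) ^+ s * g (v (s o1)) (v (s o0)) * rest s).
    by apply: eq_bigr => s _; rewrite /F /G wg mulrBr mulrBl.
  rewrite sumrB mulr2n mulrDl !mul1r; congr (_ + _).
  rewrite (reindex_inj (mulgI (tperm o0 o1))) -sumrN; apply: eq_bigr => s _.
  rewrite /G /rest !permM tpermL tpermR odd_permM odd_tperm /=.
  rewrite signrN !mulNr opprK; congr (_ * _ * _).
  by apply: eq_bigr => i _; rewrite !permM !tpermD.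
(* a permutation of the last 2k arguments, extended by the identity *)
pose ext (t : 'S_k.*2) : 'S_k.+1.*2 := lift_perm ord0 ord0 (lift_perm ord0 ord0 t).
have ext0 t : ext t o0 = o0.
  by rewrite (_ : o0 = ord0) ?lift_perm_id //; exact: val_inj.
have ext1 t : ext t o1 = o1.
  by rewrite (_ : o1 = lift ord0 ord0) ?lift_perm_lift ?lift_perm_id //; exact: val_inj.
have extr t (j : 'I_k.*2) : ext t (rshift 2 j : 'I_k.+1.*2) = rshift 2 (t j).
  rewrite (_ : rshift 2 j = lift ord0 (lift ord0 j)) ?lift_perm_lift; last exact: val_inj.
  exact: val_inj.
have odd_ext t : ext t = t :> bool by rewrite !odd_lift_perm.
have l0 : lshift k.*2 (@ord0 1) = o0 :> 'I_k.+1.*2 by exact: val_inj.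
have l1 : lshift k.*2 (@ord_max 1) = o1 :> 'I_k.+1.*2 by exact: val_inj.
have inner (s : 'S_k.+1.*2) : wedge_exp w k (fun j : 'I_k.*2 => v (s (rshift 2 j))) =
    \sum_(t : 'S_k.*2) (-1) ^+ t * rest (ext t * s)%g.
  rewrite IH; apply: eq_bigr => t _; congr (_ * _); apply: eq_bigr => i _.
  rewrite !permM (_ : even_pos (lift ord0 i) = rshift 2 (even_pos i)); last exact: val_inj.
  rewrite (_ : odd_pos (lift ord0 i) = rshift 2 (odd_pos i)); last exact: val_inj.
  by rewrite !extr.
have -> : \sum_(s : 'S_(2 + k.*2)) (-1) ^+ s * w (v (s (lshift k.*2 ord0)))
      (v (s (lshift k.*2 ord_max))) * wedge_exp w k (fun j => v (s (rshift 2 j))) =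
    \sum_(t : 'S_k.*2) \sum_s F s.
  transitivity (\sum_s \sum_(t : 'S_k.*2) F (ext t * s)%g).
    apply: eq_bigr => s _; rewrite inner big_distrr; apply: eq_bigr => t _ /=.
    rewrite /F !permM ext0 ext1 odd_permM odd_ext signr_addb.
    rewrite l0 l1.
    by rewrite -!mulrA [in RHS]mulrCA; congr (_ * _); rewrite mulrCA.
  by rewrite exchange_big /=; apply: eq_bigr => t _; rewrite [RHS](reindex_inj (mulgI (ext t))).
rewrite FG sumr_const card_Sn pfG -[X in _ * X = _]mulr_natl mulrA mulrA -mulrA.
by rewrite -[(k.*2)`!%:R * 2]natrM [((k.*2)`! * 2)%N]mulnC mulrA mulVf ?mul1r //.
Qed.
End WedgeExp.

Lemma half_pos_subproof k (j : 'I_k.*2) : (j./2 < k)%N.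
Proof. by rewrite ltn_half_double. Qed.

(** The pair to which a slot belongs. *)
Definition half_pos k (j : 'I_k.*2) : 'I_k := Ordinal (half_pos_subproof j).

Lemma half_even_pos k (i : 'I_k) : half_pos (even_pos i) = i.
Proof. by apply: val_inj; rewrite /= doubleK. Qed.

Lemma half_odd_pos k (i : 'I_k) : half_pos (odd_pos i) = i.
Proof. by apply: val_inj; rewrite /= uphalf_double. Qed.

(** The reordering of the slots that puts the first members of the pairs before
    the second ones. *)
Definition unpair_pos k (j : 'I_k.*2) : 'I_(k + k) :=
  if odd j then rshift k (half_pos j) else lshift k (half_pos j).

Lemma unpair_pos_inj k : injective (@unpair_pos k).
Proof.
move=> i j; rewrite /unpair_pos.
case oi: (odd i); case oj: (odd j) => /eqP;
  rewrite ?eq_lshift ?eq_rshift ?eq_lrshift ?eq_rlshift // => /eqP/(congr1 val)/= ij;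
  by apply: val_inj; rewrite /= -[LHS]odd_double_half -[RHS]odd_double_half ij oi oj.
Qed.

Lemma det_reindex (R : comNzRingType) N1 N2 (s : 'I_N1 -> 'I_N2) (B : 'M[R]_N2) :
  N1 = N2 -> injective s -> \det (\matrix_(i, j) B (s i) (s j)) = \det B.
Proof.
move=> eN; case: N2 / eN in s B * => s_inj.
have -> : \matrix_(i, j) B (s i) (s j) = row_perm (perm s_inj) (col_perm (perm s_inj) B).
  by apply/matrixP => i j; rewrite !mxE !permE.
rewrite row_permE col_permE !det_mulmx !det_perm mulrC -mulrA -signr_addb.
by rewrite odd_permV addbb mulr1.
Qed.

(** Multilinear expansion: choosing a term of g in each pair gives a
    determinant, whose row 2i is a column of P and row 2i + 1 a column of Q. *)
Lemma pf_sum_det (R : comNzRingType) (V : Type) k r (g : V -> V -> R)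
    (v : 'I_k.*2 -> V) (P Q : 'M[R]_(k.*2, r)) :
  (forall a b, g (v a) (v b) = \sum_l P a l * Q b l) ->
  pf_sum g v = \sum_(f : {ffun 'I_k -> 'I_r})
    \det (\matrix_(j, j') (if odd j then Q else P) j' (f (half_pos j))).
Proof.
move=> gPQ; rewrite /pf_sum exchange_big /=; apply: eq_bigr => s _.
rewrite -mulr_sumr; congr (_ * _).
under eq_bigr => i _ do rewrite gPQ.
rewrite bigA_distr_bigA; apply: eq_bigr => f _.
rewrite prod_pos; apply: eq_bigr => i _.
by rewrite !mxE half_even_pos half_odd_pos /= odd_double.
Qed.

(** When g factors through a space of dimension less than 2k, so do all the
    matrices of the expansion, and their determinants vanish. *)
Lemma pf_sum_low_rank (F : fieldType) (V : Type) k r (g : V -> V -> F)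
    (v : 'I_k.*2 -> V) (A : 'M[F]_(k.*2, r)) (C : 'M[F]_r) :
  (r < k.*2)%N -> (forall a b, g (v a) (v b) = (A *m C *m A^T) a b) ->
  pf_sum g v = 0.
Proof.
move=> rk gE; rewrite (@pf_sum_det _ _ _ _ _ _ A (A *m C^T)) => [|a b].
  apply: big1 => f _; rewrite -det_tr.
  pose S := \matrix_(l, j) (if odd (j : 'I_k.*2) then C (f (half_pos j)) l
                            else (l == f (half_pos j))%:R).
  have -> : (\matrix_(j, j') (if odd j then A *m C^T else A) j' (f (half_pos j)))^T
          = A *m S.
    apply/matrixP => a j; rewrite !mxE; case: ifP => oj.
      by rewrite mxE; apply: eq_bigr => l _; rewrite !mxE oj.
    rewrite (bigD1 (f (half_pos j))) //= big1 => [|l /negPf nl].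
      by rewrite mxE oj eqxx mulr1 addr0.
    by rewrite mxE oj nl mulr0.
  apply/eqP; rewrite -[_ == 0]negbK -unitfE -unitmxE -row_full_unit /row_full.
  by rewrite neq_ltn (leq_ltn_trans (mxrankM_maxl _ _) (leq_ltn_trans (rank_leq_col _) rk)).
rewrite gE -mulmxA mxE; apply: eq_bigr => l _; congr (_ * _).
by rewrite !mxE; apply: eq_bigr => c _; rewrite !mxE mulrC.
Qed.

(** An antisymmetric form is supported on its row space, on both sides. *)
Lemma antisym_row_base (F : fieldType) N (K : 'M[F]_N) : K^T = - K ->
  exists C, K = (row_base K)^T *m C *m row_base K.
Proof.
move=> antiK; set B := row_base K.
have KB : K *m pinvmx B *m B = K by apply: mulmxKpV; rewrite /B eq_row_base.
move: (pinvmx B) KB => D KB; exists (- (K *m D)^T *m D).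
have KT : K = B^T *m - (K *m D)^T by rewrite mulmxN -trmx_mul KB antiK opprK.
by rewrite -/B (mulmxA B^T) -KT KB.
Qed.

(** A two-form w = sum_ij K_ij x_i (x) x_j, where x_i is the evaluation
    ev _ i, can have a nonzero n-th power only if K has rank at least 2n. *)
Lemma wedge_exp_rank (R : realType) (V : Type) n N (w : V -> V -> R)
    (ev : V -> 'I_N -> R) (K : 'M[R]_N) (v : 'I_n.*2 -> V) :
  K^T = - K ->
  (forall a b, w a b = \sum_i \sum_j K i j * ev a i * ev b j) ->
  wedge_exp w n v != 0 -> (n.*2 <= \rank K)%N.
Proof.
move=> antiK wE; apply: contraNT; rewrite -ltnNge => rK.
have [C KC] := antisym_row_base antiK.
have w_anti a b : w b a = - w a b.
  rewrite !wE exchange_big -sumrN; apply: eq_bigr => i _.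
  rewrite -sumrN; apply: eq_bigr => j _.
  by have := congr1 (fun X : 'M[R]_N => X i j) antiK; rewrite !mxE => ->; rewrite !mulNr mulrAC.
rewrite (@wedge_exp_pf_sum _ _ _ (fun a b => (2^-1 : R) * w a b)) => [|a b]; last first.
  by rewrite (w_anti a b) mulrN opprK [_ * w a b]mulrC -splitr.
pose P : 'M[R]_(n.*2, N) := \matrix_(a, i) ev (v a) i.
apply/eqP/(@pf_sum_low_rank _ _ _ _ _ _ (P *m (row_base K)^T) ((2^-1 : R) *: C)) => // a b.
have -> : P *m (row_base K)^T *m ((2^-1 : R) *: C) *m (P *m (row_base K)^T)^T =
    2^-1 *: (P *m K *m P^T).
  by rewrite (trmx_mul P) trmxK [in RHS]KC -scalemxAr -!scalemxAl !mulmxA.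
rewrite mxE wE; congr (_ * _); rewrite -mulmxA mxE; apply: eq_bigr => i _.
rewrite !mxE mulr_sumr; apply: eq_bigr => j _.
by rewrite !mxE mulrA [ev _ _ * _]mulrC.
Qed.

(** The n-th power of the standard symplectic form is positive on a dual basis:
    the determinants of the expansion are, up to reordering the slots, those of
    block diagonal matrices with two equal blocks. *)
Lemma wedge_exp_symplectic (R : realType) (V : Type) n (w : V -> V -> R)
    (ev : V -> 'I_(n + n) -> R) (v : 'I_n.*2 -> V) :
  (forall a b, w a b = \sum_(i < n) (ev a (lshift n i) * ev b (rshift n i) -
                                     ev b (lshift n i) * ev a (rshift n i))) ->
  (forall j c, ev (v j) c = (unpair_pos j == c)%:R) ->
  0 < wedge_exp w n v.
Proof.
move=> wE vE.
rewrite (@wedge_exp_pf_sum _ _ _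
  (fun a b => \sum_(i < n) ev a (lshift n i) * ev b (rshift n i))) => [|a b]; last first.
  by rewrite wE sumrB.
rewrite (@pf_sum_det _ _ _ _ _ _ (\matrix_(a, l) ev (v a) (lshift n l))
   (\matrix_(a, l) ev (v a) (rshift n l))) => [|a b]; last first.
  by apply: eq_bigr => l _; rewrite !mxE.
(* one block: a selection matrix, equal to the identity when f is *)
pose F (f : {ffun 'I_n -> 'I_n}) : 'M[R]_n := \matrix_(i, i') (f i == i')%:R.
under eq_bigr => f _.
  rewrite (_ : \matrix_(_, _) _ =
     \matrix_(j, j') (block_mx (F f) 0 0 (F f)) (unpair_pos j) (unpair_pos j')).
    rewrite det_reindex ?addnn //; last exact: unpair_pos_inj.
    rewrite det_ublock -expr2; over.
  apply/matrixP => j j'; rewrite [LHS]mxE [RHS]mxE (fun_if (fun X : 'M[R]_(n.*2, n) => X _ _)).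
  transitivity ((unpair_pos j' == (if odd j then rshift n (f (half_pos j)) else lshift n (f (half_pos j))))%:R : R).
    by case: (odd j); rewrite mxE vE.
  rewrite /unpair_pos; case: (odd j); case: (odd j').
  - by rewrite block_mxEdr mxE eq_rshift eq_sym.
  - by rewrite block_mxEdl mxE eq_lrshift.
  - by rewrite block_mxEur mxE eq_rlshift.
  - by rewrite block_mxEul mxE eq_lshift eq_sym.
rewrite (bigD1 [ffun i => i]) //= ltr_pwDl //; last by apply: sumr_ge0 => f _; exact: sqr_ge0.
rewrite (_ : F _ = 1%:M) ?det1 ?expr1n //.
by apply/matrixP => i i'; rewrite !mxE ffunE.
Qed.

(** * Linear algebra in a neutral space *)

Lemma linfunE_linear (K : fieldType) (V W : vectType K) (f : V -> W) :
  linear f -> linfun f =1 f.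
Proof.
move=> fl; pose F : {linear V -> W} := HB.pack f (GRing.isLinear.Build K V W *:%R f fl).
exact: (lfunE F).
Qed.

Lemma eq_lfun_basis (K : fieldType) (V W : vectType K) r (X : r.-tuple V)
    (f g : 'Hom(V, W)) :
  basis_of fullv X -> (forall i, f (tnth X i) = g (tnth X i)) -> f = g.
Proof.
move=> bX fg; apply/lfunP => v.
rewrite (coord_basis bX (memvf v)) !linear_sum; apply: eq_bigr => i _.
by rewrite !linearZ -(tnth_nth 0 X i) /= fg.
Qed.

Lemma dual_separates (R : realType) (V : vectType R) (u v : V) :
  (forall psi : 'Hom(V, R^o), psi u = psi v) -> u = v.
Proof.
move=> uv; have bV := vbasisP (fullv : {vspace V}).
rewrite (coord_basis bV (memvf u)) (coord_basis bV (memvf v)).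
apply: eq_bigr => i _; congr (_ *: _).
by have := uv (linfun (coord (vbasis fullv) i : V -> R^o)); rewrite !lfunE.
Qed.

Section Neutral.
Variables (R : realType) (V : vectType R) (b : V -> V -> R).
Hypothesis b_sym : forall u v, b u v = b v u.
Hypothesis b_linear : forall k u v w, b (k *: u + v) w = k * b u w + b v w.

Lemma bform0l w : b 0 w = 0.
Proof. by have := b_linear (-1) 0 0 w; rewrite scaler0 addr0 mulN1r addNr. Qed.

Lemma bformDl u v w : b (u + v) w = b u w + b v w.
Proof. by have := b_linear 1 u v w; rewrite scale1r mul1r. Qed.

Lemma bformZl k u w : b (k *: u) w = k * b u w.
Proof. by have := b_linear k u 0 w; rewrite bform0l !addr0. Qed.

Lemma bformDr u v w : b w (u + v) = b w u + b w v.
Proof. by rewrite !(b_sym w) bformDl. Qed.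

Lemma bformZr k u w : b w (k *: u) = k * b w u.
Proof. by rewrite !(b_sym w) bformZl. Qed.

Lemma bformNl u w : b (- u) w = - b u w.
Proof. by rewrite -scaleN1r bformZl mulN1r. Qed.

Lemma bformNr u w : b w (- u) = - b w u.
Proof. by rewrite !(b_sym w) bformNl. Qed.

Lemma bform_suml (I : Type) (r : seq I) (P : pred I) (F : I -> V) w :
  b (\sum_(i <- r | P i) F i) w = \sum_(i <- r | P i) b (F i) w.
Proof. exact: (big_morph (b^~ w) (fun u v => bformDl u v w) (bform0l w)). Qed.

Lemma bform_sumr (I : Type) (r : seq I) (P : pred I) (F : I -> V) w :
  b w (\sum_(i <- r | P i) F i) = \sum_(i <- r | P i) b w (F i).
Proof. by rewrite b_sym bform_suml; apply: eq_bigr => i _; rewrite b_sym. Qed.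

Definition bformE := (bformDl, bformDr, bformNl, bformNr, bformZl, bformZr).

Lemma bform_linear_r u : linear (b u : V -> R^o).
Proof. by move=> k v w; rewrite bformDr bformZr. Qed.

Section PseudoOrthonormal.
Variables (p q : nat) (X : (p + q).-tuple V).
Hypothesis poX : pseudo_orthonormal b X.

Let s (i : 'I_(p + q)) : R := if (i < p)%N then 1 else -1.

(** Here s i is the square of the i-th vector of X. *)
Lemma po_sum_coord (c : 'I_(p + q) -> R) j :
  b (\sum_i c i *: tnth X i) (tnth X j) = s j * c j.
Proof.
rewrite bform_suml (bigD1 j) //= big1 => [|i /negPf ij].
  by rewrite addr0 bformZl poX eqxx mulrC.
by rewrite bformZl poX ij mulr0.
Qed.

Lemma po_sign_sq j : s j * s j = 1.
Proof. by rewrite /s; case: ifP; rewrite ?mulr1 // mulrNN mulr1. Qed.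

Lemma po_free : free X.
Proof.
apply/freeP => c c0 j.
have := po_sum_coord c j; under eq_bigr => i _ do rewrite (tnth_nth 0).
by rewrite c0 bform0l => /(congr1 ( *%R (s j))); rewrite mulr0 mulrA po_sign_sq mul1r.
Qed.

Lemma po_basis : \dim (fullv : {vspace V}) = (p + q)%N -> basis_of fullv X.
Proof. by move=> dV; rewrite basisEfree po_free subvf dV size_tuple leqnn. Qed.

Lemma po_decomp : basis_of fullv X ->
  forall v, v = \sum_i (s i * b v (tnth X i)) *: tnth X i.
Proof.
move=> bX v; rewrite [LHS](coord_basis bX (memvf v)); apply: eq_bigr => i _.
rewrite -tnth_nth; congr (_ *: _).
rewrite {2}(coord_basis bX (memvf v)); under eq_bigr => k _ do rewrite -tnth_nth.
by rewrite po_sum_coord mulrA po_sign_sq mul1r.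
Qed.

Lemma po_nondegenerate : basis_of fullv X -> forall u, (forall v, b u v = 0) -> u = 0.
Proof.
move=> bX u u0; rewrite (po_decomp bX u) big1 // => i _.
by rewrite u0 mulr0 scale0r.
Qed.

End PseudoOrthonormal.

Section LightLikeFrame.
Variables (n : nat) (eps : bool) (e : (n + n + (n + n)).-tuple V).
Hypothesis po_e : pseudo_orthonormal b e.

(** The k-th space-like vector e_k and the time-like vector e_(2n+k) that is
    paired with it, for k = 1, ..., 2n. *)
Definition space_like (k : 'I_(n + n)) : V := tnth e (lshift (n + n) k).
Definition time_like (k : 'I_(n + n)) : V := tnth e (rshift (n + n) k).

(** The sign in xi_k = e_k + xi_sign k * e_(2n+k). *)
Definition xi_sign (k : 'I_(n + n)) : R :=
  match fintype.split k with
  | inl _ => -1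
  | inr i => if (i : nat) == 0%N then sgn R eps else 1
  end.

Lemma xi_sign_sq k : xi_sign k * xi_sign k = 1.
Proof.
rewrite /xi_sign; case: (fintype.split k) => [_|i]; first by rewrite mulrNN mulr1.
by rewrite /sgn; case: ifP => _; [case: eps|]; rewrite ?mulrNN mulr1.
Qed.

Lemma xi_sign_l i : xi_sign (lshift n i) = -1.
Proof. by rewrite /xi_sign (unsplitK (inl i)). Qed.

Lemma tnth_xi k :
  tnth (xi_ eps e) k = space_like k + xi_sign k *: time_like k.
Proof.
rewrite tnth_mktuple /xi_sign /space_like /time_like.
case: (fintype.splitP k) => i ki.
  by have -> : k = lshift n i; [exact: val_inj | rewrite scaleN1r].
by have -> : k = rshift n i by exact: val_inj.
Qed.

Let b_space k l : b (space_like k) (space_like l) = (k == l)%:R.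
Proof. by rewrite po_e eq_lshift /= ltn_ord; case: eqP. Qed.

Let b_time k l : b (time_like k) (time_like l) = - (k == l)%:R.
Proof.
by rewrite po_e eq_rshift /= ltnNge leq_addr /=; case: eqP; rewrite ?oppr0.
Qed.

Let b_space_time k l : b (space_like k) (time_like l) = 0.
Proof. by rewrite po_e eq_lrshift. Qed.

Let b_time_space k l : b (time_like k) (space_like l) = 0.
Proof. by rewrite b_sym b_space_time. Qed.

Let b_frame := (b_space, b_time, b_space_time, b_time_space).

Lemma b_xi_space k l : b (tnth (xi_ eps e) k) (space_like l) = (k == l)%:R.
Proof. by rewrite tnth_xi !bformE !b_frame mulr0 addr0. Qed.

Lemma b_xi_time k l :
  b (tnth (xi_ eps e) k) (time_like l) = - xi_sign k * (k == l)%:R.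
Proof. by rewrite tnth_xi !bformE !b_frame add0r mulrN mulNr. Qed.

Let delta_sign k l : xi_sign k * xi_sign l * (k == l)%:R = (k == l)%:R.
Proof. by case: eqP => [->|_]; rewrite ?mulr0 // xi_sign_sq mulr1. Qed.

Lemma b_xi_xi k l : b (tnth (xi_ eps e) k) (tnth (xi_ eps e) l) = 0.
Proof.
rewrite [X in b _ X]tnth_xi !bformE b_xi_space b_xi_time mulrA mulrN mulNr.
by rewrite [xi_sign l * _]mulrC delta_sign subrr.
Qed.

Lemma xi_span_coord (c : 'I_(n + n) -> R) l :
  b (space_like l) (\sum_k c k *: tnth (xi_ eps e) k) = c l.
Proof.
rewrite bform_sumr (bigD1 l) //= big1 => [|k /negPf kl].
  by rewrite addr0 bformZr b_sym b_xi_space eqxx mulr1.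
by rewrite bformZr b_sym b_xi_space kl mulr0.
Qed.

Lemma xi_free : free (xi_ eps e).
Proof.
apply/freeP => c c0 j; rewrite -(xi_span_coord c j).
by under eq_bigr => k _ do rewrite (tnth_nth 0); rewrite c0 b_sym bform0l.
Qed.

(** In a subspace spanned by xi, the forms b e_k are the coordinates. *)
Lemma xi_coord (L : {vspace V}) v : basis_of L (xi_ eps e) -> v \in L ->
  v = \sum_k b (space_like k) v *: tnth (xi_ eps e) k.
Proof.
move=> bL /(coord_basis bL) vE; under eq_bigr => k _ do rewrite {1}vE.
rewrite {1}vE; apply: eq_bigr => k _; rewrite -tnth_nth; congr (_ *: _).
by under eq_bigr => l _ do rewrite -tnth_nth; rewrite xi_span_coord.
Qed.

Let xl i := tnth (xi_ eps e) (lshift n i).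
Let xr i := tnth (xi_ eps e) (rshift n i).

(** The nilpotent endomorphism attached to the frame e. *)
Definition xi_end (a : V) : V :=
  \sum_(i < n) (b (xl i) a *: xr i - b (xr i) a *: xl i).

Lemma xi_end_linear : linear xi_end.
Proof.
move=> k u v; rewrite /xi_end scaler_sumr -big_split; apply: eq_bigr => i _ /=.
rewrite !bformE !scalerDl scalerBr !scalerA opprD -!addrA; congr (_ + _).
by rewrite addrCA.
Qed.

Lemma xi_end_pick (a : V) (c : 'I_(n + n) -> R) :
  (forall k, b (tnth (xi_ eps e) k) a = c k) ->
  xi_end a = \sum_(i < n) (c (lshift n i) *: xr i - c (rshift n i) *: xl i).
Proof. by move=> bc; apply: eq_bigr => i _; rewrite /xl /xr !bc. Qed.

Lemma xi_end_l (a : V) (t : R) i :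
  (forall k, b (tnth (xi_ eps e) k) a = t * (k == lshift n i)%:R) ->
  xi_end a = t *: xr i.
Proof.
move=> /xi_end_pick ->; rewrite (bigD1 i) //= big1 => [|j /negPf ji].
  by rewrite eqxx eq_rlshift mulr1 mulr0 scale0r subr0 addr0.
by rewrite eq_lshift ji eq_rlshift mulr0 !scale0r subr0.
Qed.

Lemma xi_end_r (a : V) (t : R) i :
  (forall k, b (tnth (xi_ eps e) k) a = t * (k == rshift n i)%:R) ->
  xi_end a = - (t *: xl i).
Proof.
move=> /xi_end_pick ->; rewrite (bigD1 i) //= big1 => [|j /negPf ji].
  by rewrite eqxx eq_lrshift mulr1 mulr0 scale0r sub0r addr0.
by rewrite eq_rshift ji eq_lrshift mulr0 !scale0r subr0.
Qed.

Lemma xi_end_space_l i : xi_end (space_like (lshift n i)) = xr i.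
Proof. by rewrite (@xi_end_l _ 1 i) ?scale1r // => k; rewrite b_xi_space mul1r. Qed.

Lemma xi_end_space_r i : xi_end (space_like (rshift n i)) = - xl i.
Proof. by rewrite (@xi_end_r _ 1 i) ?scale1r // => k; rewrite b_xi_space mul1r. Qed.

Lemma xi_end_time_l i : xi_end (time_like (lshift n i)) = xr i.
Proof.
rewrite (@xi_end_l _ 1 i) ?scale1r // => k; rewrite b_xi_time.
by case: eqP => [->|]; rewrite ?mulr0 // xi_sign_l opprK.
Qed.

Lemma xi_end_time_r i :
  xi_end (time_like (rshift n i)) = xi_sign (rshift n i) *: xl i.
Proof.
rewrite (@xi_end_r _ (- xi_sign (rshift n i)) i) ?scaleNr ?opprK // => k; rewrite b_xi_time.
by case: eqP => [->|]; rewrite ?mulr0.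
Qed.

Lemma xi_end_xi k : xi_end (tnth (xi_ eps e) k) = 0.
Proof.
by rewrite (@xi_end_pick _ (fun=> 0)) => [|l]; rewrite ?b_xi_xi // big1 // => i _;
  rewrite !scale0r subr0.
Qed.

Section Nilpotent.
Variable T : 'End(V).
Hypothesis be : basis_of fullv e.

(* The columns of the product e I'. *)
Lemma frame_mulI_space k :
  tnth (frame_mul e (I'_ R n eps)) (lshift (n + n) k) = space_like k.
Proof.
rewrite tnth_mktuple big_split_ord /= (bigD1 k) //= !big1 => [|j _|j /negPf jk].
- by rewrite block_mxEul mxE eqxx scale1r !addr0.
- by rewrite block_mxEdl mxE scale0r.
- by rewrite block_mxEul mxE jk scale0r.
Qed.

Lemma frame_mulI_time_l i :
  tnth (frame_mul e (I'_ R n eps)) (rshift (n + n) (lshift n i)) = time_like (lshift n i).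
Proof.
rewrite tnth_mktuple big_split_ord /= big1 => [|j _]; last first.
  by rewrite block_mxEur mxE scale0r.
rewrite add0r big_split_ord /= (bigD1 i) //= !big1 => [|j _|j /negPf jk].
- by rewrite block_mxEdr block_mxEul mxE eqxx scale1r !addr0.
- by rewrite block_mxEdr block_mxEdl mxE scale0r.
- by rewrite block_mxEdr block_mxEul mxE jk scale0r.
Qed.

Lemma frame_mulI_time_r i :
  tnth (frame_mul e (I'_ R n eps)) (rshift (n + n) (rshift n i)) =
  xi_sign (rshift n i) *: time_like (rshift n i).
Proof.
rewrite tnth_mktuple big_split_ord /= big1 => [|j _]; last first.
  by rewrite block_mxEur mxE scale0r.
rewrite add0r big_split_ord /= big1 ?add0r => [|j _]; last first.
  by rewrite block_mxEdr block_mxEur mxE scale0r.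
rewrite (bigD1 i) //= big1 => [|j /negPf jk].
  rewrite block_mxEdr block_mxEdr !mxE eqxx addr0 /xi_sign.
  by rewrite (unsplitK (inr i)).
by rewrite block_mxEdr block_mxEdr !mxE jk scale0r.
Qed.

Lemma frame_mulL (Y : (n + n + (n + n)).-tuple V) i :
  let y1 := tnth Y (lshift (n + n) (lshift n i)) in
  let y2 := tnth Y (lshift (n + n) (rshift n i)) in
  let y3 := tnth Y (rshift (n + n) (lshift n i)) in
  let y4 := tnth Y (rshift (n + n) (rshift n i)) in
  let Z := frame_mul Y (Lambda_ R n) in
  [/\ tnth Z (lshift (n + n) (lshift n i)) = y2 + y4,
      tnth Z (lshift (n + n) (rshift n i)) = - y1 + y3,
      tnth Z (rshift (n + n) (lshift n i)) = y2 + y4 &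
      tnth Z (rshift (n + n) (rshift n i)) = y1 - y3].
Proof.
move=> y1 y2 y3 y4 Z.
have pick (c : R) (F : 'I_n -> V) (A : 'I_n -> R) :
    (forall j, A j = c *+ (j == i)) -> \sum_j A j *: F j = c *: F i.
  move=> Ac; rewrite (bigD1 i) //= big1 => [|j /negPf ji]; rewrite Ac ?eqxx ?addr0 //.
  by rewrite ji scale0r.
have pick4 c1 c2 c3 c4 k :
    (forall j, Lambda_ R n (lshift (n + n) (lshift n j)) k = c1 *+ (j == i)) ->
    (forall j, Lambda_ R n (lshift (n + n) (rshift n j)) k = c2 *+ (j == i)) ->
    (forall j, Lambda_ R n (rshift (n + n) (lshift n j)) k = c3 *+ (j == i)) ->
    (forall j, Lambda_ R n (rshift (n + n) (rshift n j)) k = c4 *+ (j == i)) ->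
    tnth Z k = c1 *: y1 + c2 *: y2 + (c3 *: y3 + c4 *: y4).
  move=> A1 A2 A3 A4; rewrite tnth_mktuple big_split_ord /= !big_split_ord /=.
  by rewrite (pick _ _ _ A1) (pick _ _ _ A2) (pick _ _ _ A3) (pick _ _ _ A4).
have blockE := (block_mxEul, block_mxEur, block_mxEdl, block_mxEdr).
split; [rewrite (pick4 0 1 0 1) | rewrite (pick4 (-1) 0 1 0)
       | rewrite (pick4 0 1 0 1) | rewrite (pick4 1 0 (-1) 0)].
all: rewrite ?(scale0r, scale1r, scaleN1r, add0r, addr0) //.
all: by move=> j; rewrite !blockE !mxE ?mul0rn ?mulNrn.
Qed.

(** The matrix equation defining nilpotent structures, frame by frame. *)
Lemma nilpotent_frameP :
  map_tuple T (frame_mul e (I'_ R n eps)) =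
    frame_mul (frame_mul e (I'_ R n eps)) (Lambda_ R n) <->
  (forall a, T a = xi_end a).
Proof.
set Y := frame_mul e _; set Z := frame_mul Y _.
have ZE i : [/\ tnth Z (lshift (n + n) (lshift n i)) = xr i,
    tnth Z (lshift (n + n) (rshift n i)) = - xl i,
    tnth Z (rshift (n + n) (lshift n i)) = xr i &
    tnth Z (rshift (n + n) (rshift n i)) = xl i].
  have [-> -> -> ->] := frame_mulL Y i.
  rewrite !frame_mulI_space frame_mulI_time_l frame_mulI_time_r.
  by rewrite /xl /xr !tnth_xi xi_sign_l scaleN1r opprB [- _ + _]addrC.
split=> [TY a|TE]; last first.
  apply: eq_from_tnth => j; rewrite tnth_map TE.
  case: (split_ordP j) => {j} j ->; case: (split_ordP j) => {j} i ->; have [E1 E2 E3 E4] := ZE i.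
  - by rewrite E1 frame_mulI_space xi_end_space_l.
  - by rewrite E2 frame_mulI_space xi_end_space_r.
  - by rewrite E3 frame_mulI_time_l xi_end_time_l.
  - rewrite E4 frame_mulI_time_r -(linfunE_linear xi_end_linear) linearZ /=.
    by rewrite (linfunE_linear xi_end_linear) xi_end_time_r scalerA xi_sign_sq scale1r.
have TYj j : T (tnth Y j) = tnth Z j by rewrite -TY [RHS]tnth_map.
suff -> : T = linfun xi_end by rewrite (linfunE_linear xi_end_linear).
apply: (eq_lfun_basis be) => j; rewrite (linfunE_linear xi_end_linear).
case: (split_ordP j) => {j} j ->; case: (split_ordP j) => {j} i ->; have [E1 E2 E3 E4] := ZE i.
- by rewrite -/(space_like _) xi_end_space_l -E1 -TYj frame_mulI_space.
- by rewrite -/(space_like _) xi_end_space_r -E2 -TYj frame_mulI_space.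
- by rewrite -/(time_like _) xi_end_time_l -E3 -TYj frame_mulI_time_l.
- rewrite -/(time_like _) xi_end_time_r -E4 -TYj frame_mulI_time_r.
  by rewrite linearZ scalerA xi_sign_sq scale1r.
Qed.

(** The image contains every xi_k, up to sign the image of a space-like vector,
    and is spanned by them; the kernel contains the xi_k, which are mutually
    orthogonal, and has the same dimension. *)
Lemma xi_end_limg : (forall a, T a = xi_end a) ->
  basis_of (limg T) (xi_ eps e) /\ limg T = lker T.
Proof.
move=> TE; have xiT k : tnth (xi_ eps e) k \in limg T.
  case: (split_ordP k) => {k} i ->.
    by rewrite -[tnth _ _]/(xl i) -[xl i]opprK -(xi_end_space_r i) -TE rpredN memv_img ?memvf.
  by rewrite -[tnth _ _]/(xr i) -xi_end_space_l -TE memv_img ?memvf.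
have sub_span : (limg T <= <<xi_ eps e>>)%VS.
  apply/subvP => _ /memv_imgP[a _ ->]; rewrite TE /xi_end.
  apply: rpred_sum => i _; apply: rpredB; apply: rpredZ; apply: memv_span; exact: mem_tnth.
have xiK : (<<xi_ eps e>> <= lker T)%VS.
  apply/span_subvP => _ /tnthP[k ->]; by rewrite memv_ker TE xi_end_xi.
have bxi : basis_of (limg T) (xi_ eps e).
  rewrite basisEfree; apply/and3P; split; [exact: xi_free| |]; first by apply/span_subvP => _ /tnthP[k ->].
  by apply: leq_trans (dimvS sub_span) _; exact: dim_span.
split=> //; have dT := size_basis bxi.
apply/eqP; rewrite eqEdim (subv_trans sub_span xiK) /=.
have := limg_ker_dim T fullv; rewrite capfv (size_basis be) -[limg T]/(T @: fullv)%VS dT.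
by move/addIn => ->.
Qed.

End Nilpotent.

End LightLikeFrame.
End Neutral.

(** * Pseudo-orthogonal changes of frame *)
(* A frame (e, f) of space-like and time-like vectors gives the null vectors
   e + tau f and e - tau f.  Transforming the former by Z and the latter by the
   contragredient W of Z is a pseudo-orthogonal change of frame. *)
Section ChangeOfFrame.
Variables (R : realType) (N : nat) (tau : 'I_N -> R).
Hypothesis tau_sq : forall k, tau k * tau k = 1.

(** The diagonal matrix of signs tau. *)
Definition tau_mx : 'M[R]_N := diag_mx (\row_k tau k).

Lemma tau_mx_sq : tau_mx *m tau_mx = 1%:M.
Proof.
apply/matrixP => i j; rewrite mul_diag_mx !mxE; case: eqP => [->|]; last by rewrite mulr0.
by rewrite tau_sq.
Qed.

Lemma tau_mx_tr : tau_mx^T = tau_mx.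
Proof. exact: tr_diag_mx. Qed.

(** Matrix, by rows, of the null vectors e + tau f, e - tau f in the frame
    (e, f), and its inverse. *)
Definition null_mx : 'M[R]_(N + N) := block_mx 1%:M tau_mx 1%:M (- tau_mx).
Definition half_unnull_mx : 'M[R]_(N + N) :=
  (2^-1 : R) *: block_mx 1%:M 1%:M tau_mx (- tau_mx).

Let half_twice n1 n2 (A : 'M[R]_(n1, n2)) : (2^-1 : R) *: (A + A) = A.
Proof. by rewrite -[A + A]mulr2n -(scaler_nat 2 A) scalerA mulVf ?scale1r ?pnatr_eq0. Qed.

Lemma null_mxK : null_mx *m half_unnull_mx = 1%:M.
Proof.
rewrite -scalemxAr mulmx_block !mul1mx !mulmxN !mulNmx !tau_mx_sq opprK subrr.
by rewrite scale_block_mx !scaler0 half_twice -scalar_mx_block.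
Qed.

Lemma half_unnull_mxK : half_unnull_mx *m null_mx = 1%:M.
Proof. exact: mulmx1C null_mxK. Qed.

(** Gram matrix of a pseudo-orthonormal frame of neutral signature. *)
Definition po_gram_mx : 'M[R]_(N + N) := block_mx 1%:M 0 0 (- 1%:M).

(** Matrix, by rows, of the new frame in the old one. *)
Definition change_mx (Z W : 'M[R]_N) : 'M[R]_(N + N) :=
  half_unnull_mx *m block_mx Z 0 0 W *m null_mx.

Lemma det_change_mx Z W : \det (change_mx Z W) = \det Z * \det W.
Proof.
rewrite !det_mulmx mulrC mulrA -det_mulmx null_mxK det1 mul1r.
exact: det_ublock.
Qed.

Lemma null_gram : null_mx *m po_gram_mx *m null_mx^T = 2 *: block_mx 0 1%:M 1%:M 0.
Proof.
rewrite /null_mx tr_block_mx !linearN /= trmx1 tau_mx_tr !mulmx_block.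
rewrite !(mulmx1, mulmx0, mul1mx, mulmxN, mulNmx, opprK, addr0, add0r) tau_mx_sq !subrr.
by rewrite scale_block_mx !scaler0 !scaler_nat !mulr2n.
Qed.

Lemma unnull_gram : half_unnull_mx *m (2 *: block_mx 0 1%:M 1%:M 0) *m half_unnull_mx^T = po_gram_mx.
Proof.
rewrite -null_gram -[RHS]mul1mx -[RHS]mulmx1 -{1}half_unnull_mxK -trmx1 -half_unnull_mxK.
by rewrite trmx_mul !mulmxA.
Qed.

Lemma change_mx_gram Z W : Z *m W^T = 1%:M ->
  change_mx Z W *m po_gram_mx *m (change_mx Z W)^T = po_gram_mx.
Proof.
move=> ZW; have WZ : W *m Z^T = 1%:M by rewrite -[W]trmxK -trmx_mul ZW trmx1.
have -> : change_mx Z W *m po_gram_mx *m (change_mx Z W)^T =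
  half_unnull_mx *m (block_mx Z 0 0 W *m (null_mx *m po_gram_mx *m null_mx^T)
    *m (block_mx Z 0 0 W)^T) *m half_unnull_mx^T by rewrite !trmx_mul !mulmxA.
rewrite null_gram -[RHS]unnull_gram; congr (_ *m _ *m _).
rewrite -scalemxAr -scalemxAl tr_block_mx !trmx0 !mulmx_block.
by rewrite !(mulmx1, mulmx0, mul1mx, mul0mx, addr0, add0r) ZW WZ.
Qed.

Lemma row_change_mx Z W :
  row_mx 1%:M tau_mx *m change_mx Z W = Z *m row_mx 1%:M tau_mx.
Proof.
have -> : row_mx 1%:M tau_mx = row_mx 1%:M 0 *m null_mx :> 'M[R]_(N, N + N).
  by rewrite mul_row_block !mul1mx !mul0mx !addr0.
rewrite /change_mx !mulmxA -(mulmxA _ null_mx half_unnull_mx) null_mxK mulmx1; congr (_ *m _).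
by rewrite mul_row_block mul_mx_row !mul1mx !mul0mx !addr0 mulmx1 mulmx0.
Qed.

End ChangeOfFrame.

Section ChangeFrame.
Variables (R : realType) (V : vectType R) (b : V -> V -> R).
Hypothesis b_sym : forall u v, b u v = b v u.
Hypothesis b_linear : forall k u v w, b (k *: u + v) w = k * b u w + b v w.
Variables (n : nat) (eps : bool) (e : (n + n + (n + n)).-tuple V).
Hypothesis po_e : pseudo_orthonormal b e.

Lemma po_gramE N (X : (N + N).-tuple V) :
  pseudo_orthonormal b X <->
  forall i j, b (tnth X i) (tnth X j) = po_gram_mx R N i j.
Proof.
have gE i j : po_gram_mx R N i j = if i == j then (if (i < N)%N then 1 else -1) else 0.
  case: (split_ordP i) => {}i ->; case: (split_ordP j) => {}j ->.
  - by rewrite block_mxEul mxE eq_lshift; case: eqP.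
  - by rewrite block_mxEur mxE eq_lrshift.
  - by rewrite block_mxEdl mxE eq_rlshift.
  - by rewrite block_mxEdr !mxE eq_rshift; case: eqP; rewrite ?oppr0.
by split=> H i j; rewrite H gE.
Qed.

(** The frame whose light-like vectors xi are transformed by Z and whose
    complementary null vectors are transformed by W; [frame_mul] wants the
    matrix by columns, hence the transpose. *)
Definition change_frame (Z W : 'M[R]_(n + n)) : (n + n + (n + n)).-tuple V :=
  frame_mul e (change_mx (xi_sign R eps) Z W)^T.

Lemma change_frame_po Z W : Z *m W^T = 1%:M ->
  pseudo_orthonormal b (change_frame Z W).
Proof.
move=> ZW; apply/po_gramE => i j.
rewrite -(change_mx_gram (@xi_sign_sq R n eps) ZW) !tnth_mktuple.
rewrite (bform_suml b_linear) -mulmxA mxE; apply: eq_bigr => k _.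
rewrite (bformZl b_linear) mxE; congr (_ * _).
rewrite (bform_sumr b_sym b_linear) mxE; apply: eq_bigr => l _.
by rewrite (bformZr b_sym b_linear) mulrC (po_gramE _).1.
Qed.

Lemma change_frame_xi Z W k : Z *m W^T = 1%:M ->
  tnth (xi_ eps (change_frame Z W)) k = \sum_l Z k l *: tnth (xi_ eps e) l.
Proof.
move=> ZW; pose comb N (A : 'M[R]_(N, n + n + (n + n))) i := \sum_j A i j *: tnth e j.
have comb_mul N1 N2 (A : 'M[R]_(N1, N2)) (B : 'M[R]_(N2, _)) i :
    comb _ (A *m B) i = \sum_j A i j *: comb _ B j.
  transitivity (\sum_j \sum_l (A i l * B l j) *: tnth e j).
    by apply: eq_bigr => j _; rewrite mxE scaler_suml.
  rewrite exchange_big; apply: eq_bigr => l _; rewrite scaler_sumr.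
  by apply: eq_bigr => j _; rewrite scalerA.
have xiE (Y : (n + n + (n + n)).-tuple V) l :
    tnth (xi_ eps Y) l = \sum_j row_mx 1%:M (tau_mx (xi_sign R eps)) l j *: tnth Y j.
  rewrite tnth_xi big_split_ord /= (bigD1 l) //= big1 => [|j /negPf jl]; last first.
    by rewrite row_mxEl mxE eq_sym jl scale0r.
  rewrite (bigD1 l) //= big1 => [|j /negPf jl]; last first.
    by rewrite row_mxEr !mxE eq_sym jl scale0r.
  by rewrite row_mxEl row_mxEr !mxE !eqxx scale1r !addr0.
rewrite xiE; under [RHS]eq_bigr => l _ do rewrite xiE.
rewrite -[RHS]comb_mul -(row_change_mx (@xi_sign_sq R n eps) Z W) comb_mul.
by apply: eq_bigr => j _; rewrite tnth_mktuple; congr (_ *: _); apply: eq_bigr => l _; rewrite mxE.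
Qed.

Lemma change_frame_det Z W : Z *m W^T = 1%:M -> basis_of fullv e ->
  \det (\matrix_(i, j) coord e i (tnth (change_frame Z W) j)) = 1.
Proof.
move=> ZW be; rewrite (_ : \matrix_(i, j) _ = (change_mx (xi_sign R eps) Z W)^T).
  by rewrite det_tr (det_change_mx (@xi_sign_sq R n eps)) -(det_tr W) -det_mulmx ZW det1.
apply/matrixP => i j; rewrite mxE tnth_mktuple.
under eq_bigr => k _ do rewrite (tnth_nth 0).
by rewrite coord_sum_free // (basis_free be).
Qed.

End ChangeFrame.

(** * Smooth symplectic bases *)

(** Subtracting the rank-two form built on the rows i0 and j0 of K clears these
    two rows. *)
Lemma antisym_pivot (F : fieldType) N (K : 'M[F]_N) (i0 j0 : 'I_N) :
  2%:R != 0 :> F -> K^T = - K -> K i0 j0 != 0 ->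
  let x := (K i0 j0)^-1 *: row i0 K in let y := row j0 K in
  forall j, (K - (x^T *m y - y^T *m x)) i0 j = 0 /\
            (K - (x^T *m y - y^T *m x)) j0 j = 0.
Proof.
move=> F2 antiK K0 x y j.
have anti a b : K a b = - K b a.
  by have := congr1 (fun X : 'M[F]_N => X b a) antiK; rewrite !mxE.
have diag a : K a a = 0.
  by apply/eqP; have /eqP := anti a a; rewrite -addr_eq0 -mulr2n -mulr_natl mulf_eq0 (negPf F2).
rewrite !mxE !big_ord1 !mxE !diag (anti j0 i0); split.
  by rewrite mulr0 mul0r sub0r opprK mulNr mulrA mulfV // mul1r subrr.
by rewrite mulVf // mul1r mul0r subr0 subrr.
Qed.

(** The indices other than i0 and j0. *)
Lemma two_complement k (i0 j0 : 'I_k.+2) : i0 != j0 ->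
  exists f : 'I_k -> 'I_k.+2, [/\ injective f,
    forall l, f l != i0 /\ f l != j0 &
    forall a, a != i0 -> a != j0 -> exists l, a = f l].
Proof.
move=> ij; case: (unliftP i0 j0) ij => [j1 ->|->]; last by rewrite eqxx.
move=> _; exists (fun l => lift i0 (lift j1 l)); split.
- by move=> l l' /lift_inj/lift_inj.
- move=> l; split; first by rewrite eq_sym neq_lift.
  by rewrite (inj_eq lift_inj) eq_sym neq_lift.
- move=> a; case: (unliftP i0 a) => [a1 ->|->]; last by rewrite eqxx.
  move=> _; rewrite (inj_eq lift_inj).
  by case: (unliftP j1 a1) => [l ->|->]; [exists l | rewrite eqxx].
Qed.

(** E deletes the rows i0 and j0, and its transpose puts back zeros. *)
Lemma selection_mx (F : fieldType) k (i0 j0 : 'I_k.+2) : i0 != j0 ->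
  exists E : 'M[F]_(k, k.+2), forall B : 'M[F]_k.+2,
    (forall j, B i0 j = 0 /\ B j0 j = 0) -> E^T *m (E *m B) = B.
Proof.
move=> /two_complement[f [f_inj fN f_surj]].
exists (\matrix_(l, a) (f l == a)%:R) => B B0; set E := \matrix_(_, _) _.
have EB l b : (E *m B) l b = B (f l) b.
  rewrite mxE (bigD1 (f l)) //= big1 => [|a /negPf fa]; rewrite mxE.
    by rewrite eqxx mul1r addr0.
  by rewrite eq_sym fa mul0r.
apply/matrixP => a b; rewrite mxE; under eq_bigr => l _ do rewrite EB !mxE.
have [->|ai] := eqVneq a i0.
  rewrite (B0 b).1 big1 // => l _; have [/negPf -> _] := fN l; exact: mul0r.
have [->|aj] := eqVneq a j0.
  rewrite (B0 b).2 big1 // => l _; have [_ /negPf ->] := fN l; exact: mul0r.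
have [l ->] := f_surj a ai aj.
rewrite (bigD1 l) //= eqxx mul1r big1 ?addr0 // => l' /negPf ll'.
by rewrite (inj_eq f_inj) ll' mul0r.
Qed.

(** Gram-Schmidt for alternating forms over the germs of smooth functions.  The
    rows of X and Y are the coordinates of a symplectic basis. *)
Lemma smooth_symplectic_basis (R : realType) (m : nat) (M : manifold R m) (x0 : M)
    (n N : nat) (K : M -> 'M[R]_N) : N = n.*2 ->
  smooth_mx_near x0 K -> (\forall z \near x0, (K z)^T = - K z) ->
  K x0 \in unitmx ->
  exists X Y : M -> 'M[R]_(n, N),
    [/\ smooth_mx_near x0 X, smooth_mx_near x0 Y &
        \forall z \near x0, K z = (X z)^T *m Y z - (Y z)^T *m X z].
Proof.
move=> eN; subst N.
elim: n K => [|n IH] K sK antiK unitK.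
  exists (fun=> 0), (fun=> 0); split; [exact: smooth_mx_near_cst..|].
  by near=> z; rewrite [LHS]flatmx0 [RHS]flatmx0.
have antiK0 := nbhs_singleton antiK.
have /matrix0Pn[i0 [j0 K0]] : K x0 != 0.
  by apply: contraTneq unitK => ->; rewrite unitmxE det0 unitr0.
have ij : i0 != j0.
  apply: contraNneq K0 => <-; apply/eqP.
  have := congr1 (fun X : 'M[R]_n.+1.*2 => X i0 i0) antiK0; rewrite !mxE => /eqP.
  by rewrite -addr_eq0 -mulr2n -mulr_natl mulf_eq0 pnatr_eq0 /= => /eqP.
have [E EP] := selection_mx R ij.
pose x z := (K z i0 j0)^-1 *: row i0 (K z); pose y z := row j0 (K z).
have sy : smooth_mx_near x0 y.
  by move=> i j; apply: smooth_near_eq (sK j0 j); near=> z; rewrite mxE.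
have sx : smooth_mx_near x0 x.
  apply: smooth_mx_nearZ; first exact: smooth_nearV.
  by move=> i j; apply: smooth_near_eq (sK i0 j); near=> z; rewrite mxE.
pose D z := K z - ((x z)^T *m y z - (y z)^T *m x z).
have sD : smooth_mx_near x0 D.
  apply: smooth_mx_nearD => //; apply: smooth_mx_nearN; apply: smooth_mx_nearD.
    by apply: smooth_mx_nearM => //; exact: smooth_mx_near_tr.
  by apply: smooth_mx_nearN; apply: smooth_mx_nearM => //; exact: smooth_mx_near_tr.
have antiD z : (K z)^T = - K z -> (D z)^T = - D z.
  move=> aK; rewrite /D [LHS]linearB [X in _ - X]linearB /= aK !trmx_mul !trmxK.
  by rewrite -[X in _ - X]opprB -opprD.
pose S z := E *m D z *m E^T.
have DE z : (K z)^T = - K z -> K z i0 j0 != 0 -> D z = E^T *m S z *m E.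
  move=> aK Kz; have EED : E^T *m (E *m D z) = D z.
    by apply: EP; apply: antisym_pivot => //; rewrite pnatr_eq0.
  have DEE : D z *m E^T *m E = D z.
    apply: trmx_inj; rewrite !trmx_mul trmxK antiD // !mulmxN EED //.
  by rewrite /S !mulmxA -(mulmxA _ E) EED DEE.
have sS : smooth_mx_near x0 S.
  apply: smooth_mx_nearM; last exact: smooth_mx_near_cst.
  by apply: smooth_mx_nearM => //; exact: smooth_mx_near_cst.
have antiS : \forall z \near x0, (S z)^T = - S z.
  apply: filterS antiK => z aK.
  by rewrite /S !trmx_mul trmxK antiD // mulNmx mulmxN mulmxA.
(* x^T y - y^T x has rank at most 2, so S keeps the full rank 2n *)
have unitS : S x0 \in unitmx.
  rewrite -row_full_unit /row_full eqn_leq rank_leq_col /=.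
  have : (n.*2.+2 <= \rank (row_mx (x x0)^T (y x0)^T *m col_mx (y x0) (- x x0)) + \rank (D x0))%N.
    rewrite mul_row_col mulmxN; apply: leq_trans (mxrank_add _ _).
    by rewrite addrC subrK mxrank_unit.
  rewrite -2!addn1 -addnA addnC => /leq_trans/(_ (leq_add (mulmx_max_rank _ _) (leqnn _))).
  rewrite leq_add2l => /leq_trans; apply; rewrite (DE x0) //.
  exact: leq_trans (mxrankM_maxl _ _) (mxrankM_maxr _ _).
have [X [Y [sX sY SXY]]] := IH S sS antiS unitS.
have sXE := smooth_mx_nearM sX (smooth_mx_near_cst x0 E).
have sYE := smooth_mx_nearM sY (smooth_mx_near_cst x0 E).
exists (fun z => col_mx (x z) (X z *m E)), (fun z => col_mx (y z) (Y z *m E)); split.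
- exact: (@smooth_mx_near_col _ _ _ 1 n _ _ x _ sx sXE).
- exact: (@smooth_mx_near_col _ _ _ 1 n _ _ y _ sy sYE).
have nK0 := smooth_near_neq0 (sK i0 j0) K0.
have colE (u v : 'rV[R]_n.+1.*2) (A B : 'M[R]_(n, n.+1.*2)) :
    (col_mx u A : 'M[R]_(n.+1, _))^T *m (col_mx v B : 'M[R]_(n.+1, _)) = u^T *m v + A^T *m B.
  by rewrite (@tr_col_mx _ 1 n); have := @mul_row_col R _ 1 n _ u^T A^T v B; exact.
near=> z; rewrite !colE !trmx_mul.
have -> : K z = (x z)^T *m y z - (y z)^T *m x z + D z by rewrite addrC subrK.
rewrite DE; [|by near: z|by near: z].
have -> : S z = (X z)^T *m Y z - (Y z)^T *m X z by near: z.
rewrite mulmxBr mulmxBl !mulmxA opprD addrACA //.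
Unshelve. all: by end_near. Qed.

(** * Smooth sections and the metric *)

Section Sections.
Variables (R : realType) (m : nat) (M : manifold R m) (r : nat) (E : vbundle M r).

Lemma smooth_section_sub (U V : set M) (s : forall x, E x) :
  V `<=` U -> smooth_section U s -> smooth_section V s.
Proof.
move=> VU sU t Et i; apply: smooth_on_sub (sU t Et i) => x [Vx tx].
by split=> //; exact: VU.
Qed.

Lemma smooth_section_frame (t : trivialization E r) j :
  trivs E t -> smooth_section (triv_dom t) (fun x => tnth (triv_frame t x) j).
Proof. by move=> Et t' Et' i; rewrite setIC; exact: trivs_compat. Qed.

Lemma smooth_section_sum (I : finType) (U : set M) (c : I -> M -> R)
    (s : I -> forall x, E x) : open U ->
  (forall i, smooth_on U (c i)) -> (forall i, smooth_section U (s i)) ->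
  smooth_section U (fun x => \sum_i c i x *: s i x).
Proof.
move=> oU sc ss t Et j; have oUt : open (U `&` triv_dom t).
  by apply: openI => //; exact: triv_dom_open.
have sub : U `&` triv_dom t `<=` U by move=> x [].
apply: smooth_on_eq (smooth_on_sum _ _ oUt
  (fun i => smooth_onM oUt (smooth_on_sub sub (sc i)) (ss i t Et j))) => // x _.
by rewrite linear_sum; apply: eq_bigr => i _; rewrite linearZ.
Qed.

End Sections.

Section Metric.
Variables (R : realType) (m : nat) (M : manifold R m) (p q : nat).
Variables (E : vbundle M (p + q)) (h : bundle_metric E).

Lemma metricC x (u v : E x) : h x u v = h x v u.
Proof. exact: Defs.metric_sym. Qed.

Lemma metric_linearl x k (u v w : E x) : h x (k *: u + v) w = k * h x u w + h x v w.
Proof. exact: metric_linear. Qed.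

Let h_sym := metricC.
Let h_linear := metric_linearl.
Arguments h_sym x : clear implicits.
Arguments h_linear x : clear implicits.

Lemma smooth_on_metric (U : set M) (s s' : forall x, E x) : open U ->
  smooth_section U s -> smooth_section U s' ->
  smooth_on U (fun x => h x (s x) (s' x)).
Proof.
move=> oU ss ss'; apply: smooth_on_local => x Ux.
have [t Et tx] := trivs_cover E x; exists (U `&` triv_dom t) => //.
have oUt : open (U `&` triv_dom t) by apply: openI => //; exact: triv_dom_open.
apply: (@smooth_on_eq _ _ _ _ (fun z => \sum_i \sum_j
   coord (triv_frame t z) i (s z) * (coord (triv_frame t z) j (s' z) *
     h z (tnth (triv_frame t z) i) (tnth (triv_frame t z) j)))) => //.
  move=> z [Uz tz]; have bz := triv_basis tz.
  rewrite {2}(coord_basis bz (memvf (s z))) {2}(coord_basis bz (memvf (s' z))).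
  rewrite (bform_suml (h_linear z)); apply: eq_bigr => i _.
  rewrite (bformZl (h_linear z)) (bform_sumr (h_sym z) (h_linear z)) mulr_sumr.
  apply: eq_bigr => j _.
  by rewrite (bformZr (h_sym z) (h_linear z)) -!tnth_nth.
apply: smooth_on_sum => // i; apply: smooth_on_sum => // j.
apply: smooth_onM => //; first exact: ss.
apply: smooth_onM => //; first exact: ss'.
by apply: smooth_on_sub (@metric_smooth _ _ _ _ _ _ h t Et i j) => z [].
Qed.

Lemma flatE x (a v : E x) : flat h x a v = h x a v.
Proof.
have lin a' := linfunE_linear (bform_linear_r (h_sym x) (h_linear x) a').
rewrite /flat linfunE_linear ?lin // => k u w; apply/lfunP => z.
by rewrite add_lfunE scale_lfunE !lin h_linear.
Qed.

(** A form phi is h(a, .) for a = sum_i s_i phi(X_i) X_i, where X is a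
    pseudo-orthonormal basis and s_i the square of X_i. *)
Lemma flat_surj x (phi : dual E x) : exists a, phi = flat h x a.
Proof.
have [X [bX poX]] := metric_signature h x.
pose s (i : 'I_(p + q)) : R := if (i < p)%N then 1 else -1.
exists (\sum_i (s i * phi (tnth X i)) *: tnth X i).
apply: (eq_lfun_basis bX) => j; rewrite flatE.
by rewrite (po_sum_coord (h_linear x) poX) mulrA (po_sign_sq R) mul1r.
Qed.

Lemma flatVK x (phi : dual E x) : flat h x ((flat h x)^-1%VF phi) = phi.
Proof.
by apply: limg_lfunVK; have [a ->] := flat_surj phi; rewrite memv_img ?memvf.
Qed.

Lemma flat_inj x : injective (flat h x).
Proof.
move=> u v uv; have [X [bX poX]] := metric_signature h x; apply/eqP; rewrite -subr_eq0.
apply/eqP/(po_nondegenerate (h_linear x) poX bX) => w.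
by rewrite -flatE linearB /= uv subrr zero_lfunE.
Qed.

(** This identity determines N from Theta_N and conversely. *)
Lemma Theta_flat (N : forall x, 'End(E x)) x (a : E x) (psi : dual E x) :
  Theta_ h N (flat h x a) psi = psi (N x a).
Proof.
rewrite /Theta_ /dual_metric (_ : (flat h x)^-1%VF (flat h x a) = a); last first.
  by apply: flat_inj; rewrite flatVK.
by rewrite h_sym -flatE flatVK comp_lfunE.
Qed.

Lemma Theta_inj (N N' : forall x, 'End(E x)) : Theta_ h N = Theta_ h N' -> N = N'.
Proof.
move=> NN'; apply: functional_extensionality_dep => x; apply/lfunP => a.
by apply: dual_separates => psi; rewrite -!Theta_flat NN'.
Qed.

End Metric.

Lemma dual_tupleE (R : realType) (m : nat) (M : manifold R m) (r : nat)
    (E : vbundle M r) (x : M) (X : r.-tuple (E x)) i v :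
  dual_tuple X i v = coord X i v.
Proof. exact: lfunE. Qed.

(** * Nilpotent structures and two-forms *)

Section Correspondence.
Variables (R : realType) (m : nat) (M : manifold R m) (n : nat).
Variables (E : vbundle M (n + n + (n + n))) (o : orientation E).
Variables (h : bundle_metric E) (eps : bool).

Let h_sym := metricC h.
Let h_linear := metric_linearl h.
Arguments h_sym x : clear implicits.
Arguments h_linear x : clear implicits.

(** The normal form sum_i xi_i /\ xi_(n+i). *)
Definition xi_form x (e : (n + n + (n + n)).-tuple (E x)) (phi psi : dual E x) : R :=
  \sum_(i < n) wedge (tnth (xi_ eps e) (lshift n i)) (tnth (xi_ eps e) (rshift n i)) phi psi.

Lemma xi_end_form x (e : (n + n + (n + n)).-tuple (E x)) a (psi : dual E x) :
  psi (xi_end (h x) eps e a) = xi_form e (flat h x a) psi :> R.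
Proof.
rewrite /xi_end linear_sum; apply: eq_bigr => i _.
rewrite linearB !linearZ /wedge !flatE !(h_sym x a) /=.
by congr (_ + _); rewrite scalerN; congr (- _); exact: mulrC.
Qed.

Lemma Theta_xi_formP (N : forall x, 'End(E x)) x (e : (n + n + (n + n)).-tuple (E x)) :
  Theta_ h N (x := x) = xi_form e <-> forall a, N x a = xi_end (h x) eps e a.
Proof.
split=> [TN a|NE].
  by apply: dual_separates => psi; rewrite -(Theta_flat h) TN xi_end_form.
apply/funext => phi; apply/funext => psi; have [a ->] := flat_surj h phi.
by rewrite Theta_flat NE xi_end_form.
Qed.

Lemma smooth_section_xi (U : set M) (e : forall x, (n + n + (n + n)).-tuple (E x)) k :
  open U -> local_frame U e -> smooth_section U (fun x => tnth (xi_ eps (e x)) k).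
Proof.
move=> oU [_ se].
pose c (j : bool) : M -> R := fun=> if j then 1 else xi_sign R eps k.
pose s (j : bool) x := tnth (e x) (if j then lshift (n + n) k else rshift (n + n) k).
have -> : (fun x => tnth (xi_ eps (e x)) k) = (fun x => \sum_j c j x *: s j x).
  by apply: functional_extensionality_dep => x; rewrite big_bool tnth_xi /c scale1r.
apply: smooth_section_sum => // j; first exact: smooth_on_cst.
exact: se.
Qed.

(** The definition of a nilpotent structure, with the matrix equation made
    explicit. *)
Lemma nilpotent_xi_end (N : forall x, 'End(E x)) : nilpotent_structure o h eps N ->
  forall x0 : M, exists (U : set M) (e : forall x, (n + n + (n + n)).-tuple (E x)),
    [/\ open U, U x0, oriented_po_frame o h U e &
        forall x, U x -> forall a, N x a = xi_end (h x) eps (e x) a].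
Proof.
move=> [_ HN] x0; have [U [e [oU Ux0 oe NeU]]] := HN x0; exists U, e; split=> // x Ux.
have [[be _] poe _] := oe.
by apply/(@nilpotent_frameP _ _ _ (h_sym x) (h_linear x) n eps _ (poe x Ux) _ (be x Ux)); exact: NeU.
Qed.

Lemma nilpotent_limg_lker N : nilpotent_structure o h eps N ->
  forall x, limg (N x) = lker (N x).
Proof.
move=> /nilpotent_xi_end HN x; have [U [e [oU Ux [[be _] poe _] NE]]] := HN x.
by have [] := xi_end_limg (h_sym x) (h_linear x) (poe x Ux) (be x Ux) (NE x Ux).
Qed.

Lemma nilpotent_lightlike N : nilpotent_structure o h eps N ->
  lightlike_subbundle o h eps (pi_ N).
Proof.
move=> /nilpotent_xi_end HN.
have bxi x0 : exists (U : set M) (e : forall x, (n + n + (n + n)).-tuple (E x)),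
    [/\ open U, U x0, oriented_po_frame o h U e &
        forall x, U x -> basis_of (pi_ N x) (xi_ eps (e x))].
  have [U [e [oU Ux oe NE]]] := HN x0; exists U, e; split=> // x Ux'.
  have [[be _] poe _] := oe.
  by have [] := xi_end_limg (h_sym x) (h_linear x) (poe x Ux') (be x Ux') (NE x Ux').
split=> // x0; have [U [e [oU Ux [fe _ _] bU]]] := bxi x0.
by exists U, (fun x => xi_ eps (e x)); split=> // i; exact: smooth_section_xi.
Qed.

Lemma nilpotent_nondegenerate N : nilpotent_structure o h eps N ->
  nondegenerate_section n (pi_ N) (Theta_ h N).
Proof.
move=> HN; have [_ bxi] := nilpotent_lightlike HN; have HN' := nilpotent_xi_end HN.
split; first split.
- move=> x; have [U [e [oU Ux [[be _] poe _] NE]]] := HN' x.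
  have [bx _] := xi_end_limg (h_sym x) (h_linear x) (poe x Ux) (be x Ux) (NE x Ux).
  exists n, (fun i => tnth (xi_ eps (e x)) (lshift n i)),
    (fun i => tnth (xi_ eps (e x)) (rshift n i)); split.
    by move=> i; split; apply: (basis_mem bx); exact: mem_tnth.
  move=> phi psi; have /Theta_xi_formP E1 := NE x Ux.
  by rewrite -[LHS]/(Theta_ h N (x := x) phi psi) E1.
- move=> t Et i j; apply: smooth_on_local => x tx.
  have [U [e [oU Ux [fe _ _] NE]]] := HN' x; exists (U `&` triv_dom t) => //.
  have oUt : open (U `&` triv_dom t) by apply: openI => //; exact: triv_dom_open.
  have sxi k l : smooth_on (U `&` triv_dom t)
      (fun x => coord (triv_frame t x) l (tnth (xi_ eps (e x)) k)).
    by have := smooth_section_xi k oU fe Et l; exact.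
  apply: (@smooth_on_eq _ _ _ _ (fun z => \sum_(k < n)
    (coord (triv_frame t z) i (tnth (xi_ eps (e z)) (lshift n k)) *
     coord (triv_frame t z) j (tnth (xi_ eps (e z)) (rshift n k)) -
     coord (triv_frame t z) j (tnth (xi_ eps (e z)) (lshift n k)) *
     coord (triv_frame t z) i (tnth (xi_ eps (e z)) (rshift n k))))) => //.
    move=> z [Uz _]; have /Theta_xi_formP -> := NE z Uz.
    by apply: eq_bigr => k _; rewrite /wedge !dual_tupleE.
  by apply: smooth_on_sum => // k; apply: smooth_onB => //; apply: smooth_onM.
- move=> x; have [U [e [oU Ux [_ poe _] NE]]] := HN' x.
  exists (fun j => flat h x (space_like (e x) (unpair_pos j))).
  rewrite lt0r_neq0 //; have := @wedge_exp_symplectic R (dual E x) n (Theta_ h N (x := x))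
    (fun phi k => phi (tnth (xi_ eps (e x)) k)); apply.
    by have /Theta_xi_formP -> := NE x Ux.
  by move=> j c; rewrite flatE h_sym (@b_xi_space _ _ _ (h_sym x) (h_linear x) n eps _ (poe x Ux)) eq_sym.
Qed.

Section FromTwoForm.
Variables (L : forall x, {vspace E x}) (Theta : forall x, dual E x -> dual E x -> R).

Lemma Lambda2_sum x (I J : finType) (c : I -> R) (d : J -> R)
    (phi : I -> dual E x) (psi : J -> dual E x) : Lambda2 L (@Theta x) ->
  Theta (\sum_i c i *: phi i) (\sum_j d j *: psi j) =
  \sum_i \sum_j c i * (d j * Theta (phi i) (psi j)).
Proof.
move=> [k [u [v [_ wE]]]]; rewrite wE.
have app (A : finType) (f : A -> R) (g : A -> dual E x) w :
    (\sum_i f i *: g i) w = \sum_i f i * g i w :> R.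
  by rewrite sum_lfunE; apply: eq_bigr => i _; rewrite scale_lfunE.
under [RHS]eq_bigr => i _.
  under eq_bigr => j _ do rewrite wE !mulr_sumr.
  rewrite exchange_big; over.
rewrite exchange_big /=; apply: eq_bigr => l _; rewrite /wedge !app.
rewrite !big_distrlr /= [X in _ - X]exchange_big -sumrB; apply: eq_bigr => i _.
rewrite -sumrB; apply: eq_bigr => j _.
by rewrite !mulrBr; congr (_ - _); rewrite mulrACA ?[d j * c i]mulrC -mulrA.
Qed.

(** The matrix of Theta on the forms h(e_a, .), for e_a space-like.  As these are
    dual to xi, it is also the matrix of coefficients of Theta on xi. *)
Definition xi_gram x (e : (n + n + (n + n)).-tuple (E x)) : 'M[R]_(n + n) :=
  \matrix_(a, b) Theta (flat h x (space_like e a)) (flat h x (space_like e b)).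

Lemma xi_gram_antisym x e : Lambda2 L (@Theta x) -> (xi_gram e)^T = - @xi_gram x e.
Proof.
move=> [k [u [v [_ wE]]]]; apply/matrixP => a b; rewrite !mxE !wE -sumrN.
by apply: eq_bigr => i _; rewrite /wedge opprB.
Qed.

Lemma Lambda2_xi_gram x e phi psi : Lambda2 L (@Theta x) ->
  pseudo_orthonormal (h x) e -> basis_of (L x) (xi_ eps e) ->
  Theta phi psi = \sum_a \sum_b @xi_gram x e a b * phi (tnth (xi_ eps e) a) *
                                            psi (tnth (xi_ eps e) b).
Proof.
move=> [k [u [v [uvL wE]]]] poe bL; rewrite wE.
under [RHS]eq_bigr => a _.
  under eq_bigr => b _ do rewrite mxE wE !mulr_suml.
  rewrite exchange_big; over.
rewrite exchange_big /=; apply: eq_bigr => l _; have [uL vL] := uvL l.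
rewrite /wedge; under [RHS]eq_bigr => a _ do under eq_bigr => b _ do rewrite !flatE.
have coordE w (f : dual E x) : w \in L x ->
    f w = \sum_a h x (space_like e a) w * f (tnth (xi_ eps e) a) :> R.
  move=> wL; rewrite {1}(xi_coord (h_sym x) (h_linear x) poe bL wL) linear_sum.
  by apply: eq_bigr => a _; rewrite linearZ.
rewrite (coordE _ phi uL) (coordE _ psi vL) (coordE _ psi uL) (coordE _ phi vL).
rewrite !big_distrlr /= [X in _ - X]exchange_big -sumrB; apply: eq_bigr => a _.
rewrite -sumrB; apply: eq_bigr => b _; rewrite !mulrBl.
by congr (_ - _); rewrite mulrACA; [rewrite mulrA | rewrite [X in _ * X]mulrC mulrA].
Qed.

Hypothesis L_lightlike : lightlike_subbundle o h eps L.
Hypothesis Theta_nondegenerate : nondegenerate_section n L Theta.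

Lemma xi_gram_unit x e : pseudo_orthonormal (h x) e -> basis_of (L x) (xi_ eps e) ->
  @xi_gram x e \in unitmx.
Proof.
move=> poe bL; have [[Lx _] /(_ x)[v Hv]] := Theta_nondegenerate.
rewrite -row_full_unit /row_full eqn_leq rank_leq_col /= {1}addnn.
apply: (wedge_exp_rank (xi_gram_antisym e (Lx x)) _ Hv) => phi psi.
by rewrite (Lambda2_xi_gram _ _ (Lx x) poe bL).
Qed.

(** The coordinates of h(e_a, .) in the frame dual to a trivialization are the
    products h(e_a, t_i), so no matrix has to be inverted. *)
Lemma smooth_xi_gram (U : set M) e x0 : open U -> U x0 -> oriented_po_frame o h U e ->
  smooth_mx_near x0 (fun x => xi_gram (e x)).
Proof.
move=> oU Ux0 [fe poe _] a b; have [[Lx sTheta] _] := Theta_nondegenerate.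
have [t Et tx0] := trivs_cover E x0.
have oUt : open (U `&` triv_dom t) by apply: openI => //; exact: triv_dom_open.
exists (U `&` triv_dom t); split=> //.
have sh k (i : 'I_(n + n + (n + n))) : smooth_on (U `&` triv_dom t)
   (fun z => h z (space_like (e z) k) (tnth (triv_frame t z) i)).
  apply: smooth_on_metric => //.
    by apply: (@smooth_section_sub _ _ _ _ _ U) => [z []//|]; have [_] := fe; exact.
  apply: (@smooth_section_sub _ _ _ _ _ (triv_dom t)) => [z []//|].
  exact: smooth_section_frame.
apply: (@smooth_on_eq _ _ _ _ (fun z => \sum_i \sum_j
   h z (space_like (e z) a) (tnth (triv_frame t z) i) *
  (h z (space_like (e z) b) (tnth (triv_frame t z) j) *
   Theta (dual_tuple (triv_frame t z) i) (dual_tuple (triv_frame t z) j)))) => //.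
  move=> z [Uz tz]; rewrite -(Lambda2_sum _ _ _ _ (Lx z)) mxE.
  have flat_dual u : \sum_i h z u (tnth (triv_frame t z) i) *: dual_tuple (triv_frame t z) i
      = flat h z u.
    apply: (eq_lfun_basis (triv_basis tz)) => j; rewrite sum_lfunE flatE (bigD1 j) //= big1.
      rewrite scale_lfunE dual_tupleE (tnth_nth 0) coord_free ?(basis_free (triv_basis tz)) //.
      by rewrite eqxx addr0 -tnth_nth [LHS]mulr1.
    move=> i /negPf ij; rewrite scale_lfunE dual_tupleE (tnth_nth 0 _ j).
    rewrite coord_free ?(basis_free (triv_basis tz)) // -[_ == _]/(j == i) eq_sym ij.
    by rewrite [LHS]mulr0.
  by rewrite !flat_dual.
apply: smooth_on_sum => // i; apply: smooth_on_sum => // j; apply: smooth_onM => //.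
apply: smooth_onM => //; apply: (@smooth_on_sub _ _ _ (triv_dom t)); first by move=> z [].
exact: sTheta.
Qed.

(** Around each point, Theta has the normal form in some positively oriented
    pseudo-orthonormal frame. *)
Lemma symplectic_adapted_frame x0 :
  exists (U : set M) (e : forall x, (n + n + (n + n)).-tuple (E x)),
    [/\ open U, U x0, oriented_po_frame o h U e &
        forall x, U x -> Theta (x := x) = xi_form (e x)].
Proof.
have [_ /(_ x0)[U [e [oU Ux0 oe bL]]]] := L_lightlike.
have [[be se] poe ore] := oe; have [[Lx _] _] := Theta_nondegenerate.
have sK := smooth_xi_gram oU Ux0 oe.
have nU := open_nbhs_nbhs (conj oU Ux0).
have unitK z : U z -> xi_gram (e z) \in unitmx.
  by move=> Uz; apply: xi_gram_unit; [exact: poe | exact: bL].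
have antiK : \forall z \near x0, (xi_gram (e z))^T = - xi_gram (e z).
  by near=> z; exact: xi_gram_antisym.
have [X [Y [sX sY KXY]]] := smooth_symplectic_basis (addnn n) sK antiK (unitK _ Ux0).
pose Z z := col_mx (X z) (Y z).
have unitZ z : U z -> xi_gram (e z) = (X z)^T *m Y z - (Y z)^T *m X z -> Z z \in unitmx.
  move=> Uz KE; have := unitK z Uz.
  rewrite -!row_full_unit /row_full !eqn_leq !rank_leq_col /= => /leq_trans; apply.
  rewrite (_ : xi_gram _ = row_mx (- (Y z)^T) (X z)^T *m Z z) ?mxrankM_maxr //.
  by rewrite KE mul_row_col mulNmx addrC.
pose W z := (invmx (Z z))^T.
have sZ : smooth_mx_near x0 Z by exact: smooth_mx_near_col.
have sW : smooth_mx_near x0 W.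
  apply: smooth_mx_near_tr; apply: smooth_mx_near_inv => //.
  by apply: unitZ => //; exact: nbhs_singleton KXY.
pose B z := (change_mx (xi_sign R eps) (Z z) (W z))^T.
have sB : smooth_mx_near x0 B.
  apply: smooth_mx_near_tr; apply: smooth_mx_nearM; last exact: smooth_mx_near_cst.
  apply: smooth_mx_nearM; first exact: smooth_mx_near_cst.
  by apply: smooth_mx_near_col; apply: smooth_mx_near_row => //; exact: smooth_mx_near_cst.
have [V [oV Vx0 sBV]] := smooth_near_forall (fun ij : 'I__ * 'I__ => sB ij.1 ij.2).
have /near_open[V' [oV' V'x0 KV']] := KXY.
pose U' := U `&` (V `&` V'); pose e' z := change_frame eps (e z) (Z z) (W z).
have oU' : open U' by apply: openI => //; exact: openI.
have ZW z : U' z -> Z z *m (W z)^T = 1%:M.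
  by move=> [Uz [_ /KV' KE]]; rewrite trmxK mulmxV // unitZ.
have po' z : U' z -> pseudo_orthonormal (h z) (e' z).
  by move=> Uz; apply: change_frame_po; [exact: h_sym | exact: h_linear
    | case: Uz => Uz _; exact: poe | exact: ZW].
have b' z : U' z -> basis_of fullv (e' z).
  move=> Uz; apply: (po_basis (h_linear z) (po' z Uz)).
  by rewrite (size_basis (be z Uz.1)).
exists U', e'; split=> //; first split=> //.
- split=> // j; apply: smooth_section_sub (_ : U' `<=` U `&` V) _.
    by move=> z [Uz [Vz _]].
  have oUV : open (U `&` V) by exact: openI.
  have := @smooth_section_sum _ _ _ _ E _ _ (fun i z => B z i j) (fun i z => tnth (e z) i) oUV.
  rewrite (_ : (fun z => tnth (e' z) j) = (fun z => \sum_i B z i j *: tnth (e z) i)).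
    apply=> i; first by apply: smooth_on_sub (sBV (i, j)) => z [].
    by apply: smooth_section_sub (se i) => z [].
  by apply: functional_extensionality_dep => z; rewrite tnth_mktuple.
- move=> z Uz; apply/(positive_class (ore z Uz.1) (b' z Uz)).
  by rewrite change_frame_det ?ltr01 //; [exact: ZW | exact: be z Uz.1].
- move=> z Uz; apply/funext => phi; apply/funext => psi.
  rewrite (Lambda2_xi_gram _ _ (Lx z) (poe z Uz.1) (bL z Uz.1)).
  have xi'E (f : dual E z) k : f (tnth (xi_ eps (e' z)) k) =
      \sum_l Z z k l * f (tnth (xi_ eps (e z)) l) :> R.
    rewrite change_frame_xi; last exact: ZW.
    by rewrite linear_sum; apply: eq_bigr => l _; rewrite linearZ.
  rewrite /xi_form /wedge; under [RHS]eq_bigr => i _ do rewrite !xi'E !big_distrlr /=.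
  rewrite (KV' z Uz.2.2).
  under [RHS]eq_bigr => i _.
    rewrite [X in _ - X]exchange_big -sumrB; under eq_bigr => a _ do rewrite -sumrB; over.
  rewrite [RHS]exchange_big; apply: eq_bigr => a _; rewrite [RHS]exchange_big; apply: eq_bigr => b _.
  have -> : ((X z)^T *m Y z - (Y z)^T *m X z) a b =
      \sum_i (X z i a * Y z i b - Y z i a * X z i b).
    by rewrite !mxE -sumrB; apply: eq_bigr => i _; rewrite !mxE.
  rewrite !mulr_suml; apply: eq_bigr => i _.
  rewrite /Z !col_mxEu !col_mxEd !mulrBl -!mulrA; congr (_ - _).
    by congr (_ * _); exact: mulrCA.
  by rewrite mulrCA; congr (_ * _); rewrite [LHS]mulrA; exact: mulrC.
Unshelve. all: by end_near. Qed.

(** N is determined at each point by psi (N a) = Theta (h(a, .), psi), so it can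
    be chosen pointwise; its smoothness and its matrix equation follow from the
    local normal form of Theta. *)
Lemma exists_nilpotent : exists2 N, nilpotent_structure o h eps N & Theta_ h N = Theta.
Proof.
have ex x : exists T : 'End(E x), forall a (psi : dual E x),
    psi (T a) = Theta (flat h x a) psi.
  have [U [e [oU Ux _ TE]]] := symplectic_adapted_frame x.
  exists (linfun (xi_end (h x) eps (e x))) => a psi.
  rewrite linfunE_linear ?xi_end_form ?(TE x Ux) //.
  exact: (@xi_end_linear _ _ _ (h_sym x) (h_linear x)).
pose N x := projT1 (cid (ex x)).
have NTheta : Theta_ h N = Theta.
  apply: functional_extensionality_dep => x; apply/funext => phi; apply/funext => psi.
  have [a ->] := flat_surj h phi; rewrite Theta_flat.
  exact: (projT2 (cid (ex x))).
exists N => //; split=> [t Et j t' Et' i|x0]; last first.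
  have [U [e [oU Ux oe TE]]] := symplectic_adapted_frame x0; exists U, e; split=> // x Ux'.
  have [[be _] poe _] := oe.
  apply/(@nilpotent_frameP _ _ _ (h_sym x) (h_linear x) n eps _ (poe x Ux') _ (be x Ux')).
  by apply/Theta_xi_formP; rewrite NTheta TE.
apply: smooth_on_local => x [tx t'x].
have [U [e [oU Ux [fe _ _] TE]]] := symplectic_adapted_frame x.
pose V := U `&` (triv_dom t `&` triv_dom t').
have oV : open V by apply: openI => //; apply: openI; exact: triv_dom_open.
exists V => //.
have sxi k : smooth_section V (fun z => tnth (xi_ eps (e z)) k).
  by apply: (@smooth_section_sub _ _ _ _ _ U) => [z []//|]; exact: smooth_section_xi.
have sh k : smooth_on V (fun z => h z (tnth (xi_ eps (e z)) k) (tnth (triv_frame t z) j)).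
  apply: smooth_on_metric => //.
  by apply: (@smooth_section_sub _ _ _ _ _ (triv_dom t)) => [z [_ []]//|]; exact: smooth_section_frame.
have sc k : smooth_on V (fun z => coord (triv_frame t' z) i (tnth (xi_ eps (e z)) k)).
  by apply: (@smooth_on_sub _ _ _ (V `&` triv_dom t')); [move=> z Vz; split=> //; case: Vz => _ [] | exact: sxi].
apply: (@smooth_on_eq _ _ _ _ (fun z => \sum_(k < n)
   (h z (tnth (xi_ eps (e z)) (lshift n k)) (tnth (triv_frame t z) j) *
      coord (triv_frame t' z) i (tnth (xi_ eps (e z)) (rshift n k)) -
    h z (tnth (xi_ eps (e z)) (rshift n k)) (tnth (triv_frame t z) j) *
      coord (triv_frame t' z) i (tnth (xi_ eps (e z)) (lshift n k))))) => //.
  move=> z [Uz _]; have /Theta_xi_formP -> : Theta_ h N (x := z) = xi_form (e z) by rewrite NTheta TE.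
  by rewrite linear_sum; apply: eq_bigr => k _; rewrite linearB !linearZ.
by apply: smooth_on_sum => // k; apply: smooth_onB => //; apply: smooth_onM.
Qed.

End FromTwoForm.

End Correspondence.

Theorem theorem2p1 (R : realType) (m : nat) (M : manifold R m) (n : nat)
    (n_gt0 : (0 < n)%N) (E : vbundle M (n + n + (n + n)))
    (o : orientation E) (h : bundle_metric E) (eps : bool) :
  (forall N : forall x, 'End(E x), nilpotent_structure o h eps N ->
     [/\ forall x, limg (N x) = lker (N x),
         lightlike_subbundle o h eps (pi_ N) &
         nondegenerate_section n (pi_ N) (Theta_ h N)]) /\
  set_bij
    [set N : forall x, 'End(E x) | nilpotent_structure o h eps N]
    [set Theta : forall x, dual E x -> dual E x -> R |
       exists2 L : forall x, {vspace E x},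
         lightlike_subbundle o h eps L & nondegenerate_section n L Theta]
    (Theta_ h).
Proof.
have fwd N : nilpotent_structure o h eps N ->
    lightlike_subbundle o h eps (pi_ N) /\ nondegenerate_section n (pi_ N) (Theta_ h N).
  by move=> HN; split; [exact: nilpotent_lightlike | exact: nilpotent_nondegenerate HN].
split; first by move=> N HN; have [? ?] := fwd N HN; split=> //; exact: nilpotent_limg_lker HN.
split.
- by move=> N HN; have [? ?] := fwd N HN; exists (pi_ N).
- by move=> N N' _ _; exact: Theta_inj.
- by move=> Theta [L HL HTheta]; have [N HN NTheta] := exists_nilpotent HL HTheta; exists N.
Qed.
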